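(* Let $\Gamma\subset O(4)$ be a finite subgroup acting freely on $S^3$, and let $f=\frac{|x|^2}{4}$. Suppose $v>0$ satisfies $$\Delta_f v=v\quad\text{on }\{\mathbb{R}^4/\Gamma\}\setminus\{0\}$$ and $v$ is bounded at infinity, i.e. $\limsup_{x\to\infty}v(x)<\infty$. Then $$v=b\,r^{-2}$$ for some constant $b$, where $r=|x|$.
   Context: $\mathbb{R}^4/\Gamma$ is the flat cone with its Euclidean quotient metric and vertex $0$, and $r=|x|$ is the distance to $0$. The drifted Laplacian is $\Delta_f=\Delta-\langle\nabla f,\nabla\,\cdot\,\rangle$. Solutions are smooth functions. *)

(* Defs.v *)
From HB Require Import structures.
From mathcomp Require Import all_boot all_order all_algebra.
From mathcomp Require Import all_classical all_reals all_analysis.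

Set Implicit Arguments.
Unset Strict Implicit.
Unset Printing Implicit Defensive.

Import Order.TTheory GRing.Theory Num.Theory.
Import numFieldNormedType.Exports.

Local Open Scope classical_set_scope.
Local Open Scope ring_scope.
Local Open Scope quotient_scope.

(* The norm that the library puts on 'cV[R]_n is the sup norm; it is used only
   for the topology and for (Frechet) differentiability, which do not depend
   on the choice of a norm. Lengths are measured with enorm. *)
Definition dot (R : realType) (n : nat) (x y : 'cV[R]_n) : R :=
  \sum_(i < n) x i 0 * y i 0.

Definition enorm (R : realType) (n : nat) (x : 'cV[R]_n) : R :=
  Num.sqrt (dot x x).

Definition partial (R : realType) (n : nat) (i : 'I_n) (u : 'cV[R]_n -> R) :
    'cV[R]_n -> R :=
  'D_(delta_mx i 0) u.

Definition grad (R : realType) (n : nat) (u : 'cV[R]_n -> R) (x : 'cV[R]_n) :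
    'cV[R]_n :=
  \col_i partial i u x.

Definition laplacian (R : realType) (n : nat) (u : 'cV[R]_n -> R)
    (x : 'cV[R]_n) : R :=
  \sum_(i < n) partial i (partial i u) x.

Definition drift_laplacian (R : realType) (n : nat) (f u : 'cV[R]_n -> R)
    (x : 'cV[R]_n) : R :=
  laplacian u x - dot (grad f x) (grad u x).

Definition smooth_on (R : realType) (n : nat) (U : set 'cV[R]_n)
    (u : 'cV[R]_n -> R) : Prop :=
  forall (s : seq 'I_n) (x : 'cV[R]_n), U x ->
    differentiable (foldr (@partial R n) u s) x.

Definition orthogonal_group (R : realType) (n : nat) : set 'M[R]_n :=
  [set A | A^T *m A = 1%:M].

Arguments orthogonal_group : clear implicits.

Record finOrthGroup (R : realType) (n : nat) := FinOrthGroup {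
  fog_set : set 'M[R]_n ;
  fog_finite : finite_set fog_set ;
  fog_orth : fog_set `<=` orthogonal_group R n ;
  fog1 : fog_set 1%:M ;
  fogM : forall A B, fog_set A -> fog_set B -> fog_set (A *m B) ;
  fogV : forall A, fog_set A -> fog_set (invmx A) }.

Definition acts_freely_on_sphere (R : realType) (n : nat)
    (G : finOrthGroup R n) : Prop :=
  forall (A : 'M[R]_n) (x : 'cV[R]_n),
    fog_set G A -> enorm x = 1 -> A *m x = x -> A = 1%:M.

Definition same_orbit (R : realType) (n : nat) (G : finOrthGroup R n) :
    rel 'cV[R]_n :=
  fun x y => `[< exists2 A, fog_set G A & y = A *m x >].

Lemma orthogonal_unitmx (R : realType) (n : nat) (A : 'M[R]_n) :
  orthogonal_group R n A -> A \in unitmx.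
Proof. by move=> /mulmx1_unit[]. Qed.

Lemma same_orbit_refl (R : realType) (n : nat) (G : finOrthGroup R n) :
  reflexive (same_orbit G).
Proof. by move=> x; apply/asboolP; exists 1%:M; [exact: fog1 | rewrite mul1mx]. Qed.

Lemma same_orbit_sym (R : realType) (n : nat) (G : finOrthGroup R n) :
  symmetric (same_orbit G).
Proof.
have H x y : same_orbit G x y -> same_orbit G y x.
  move=> /asboolP[A GA ->]; apply/asboolP.
  exists (invmx A); first exact: fogV.
  by rewrite mulKmx //; apply: orthogonal_unitmx; apply: fog_orth GA.
by move=> x y; apply/idP/idP; exact: H.
Qed.

Lemma same_orbit_trans (R : realType) (n : nat) (G : finOrthGroup R n) :
  transitive (same_orbit G).
Proof.
move=> y x z /asboolP[A GA ->] /asboolP[B GB ->]; apply/asboolP.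
by exists (B *m A); [exact: fogM | rewrite mulmxA].
Qed.

Canonical same_orbit_equiv (R : realType) (n : nat) (G : finOrthGroup R n) :=
  EquivRel (same_orbit G) (@same_orbit_refl R n G) (@same_orbit_sym R n G)
    (@same_orbit_trans R n G).

Definition cone (R : realType) (n : nat) (G : finOrthGroup R n) :=
  quotient_topology {eq_quot same_orbit_equiv G}.

HB.instance Definition _ (R : realType) (n : nat) (G : finOrthGroup R n) :=
  Topological.on (cone G).

HB.instance Definition _ (R : realType) (n : nat) (G : finOrthGroup R n) :=
  Quotient.on (cone G).

Definition vertex (R : realType) (n : nat) (G : finOrthGroup R n) : cone G :=
  \pi_(cone G) 0.

Definition cone_dist (R : realType) (n : nat) (G : finOrthGroup R n)
    (p q : cone G) : R :=
  inf [set enorm (x.1 - x.2) |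
        x in [set x | \pi_(cone G) x.1 = p /\ \pi_(cone G) x.2 = q]].

Definition cone_radius (R : realType) (n : nat) (G : finOrthGroup R n)
    (p : cone G) : R :=
  cone_dist p (vertex G).

Definition cone_infty (R : realType) (n : nat) (G : finOrthGroup R n) :
    set_system (cone G) :=
  filter_from setT (fun M : R => [set p | M < cone_radius p]).

Arguments cone_infty {R n} G.

(* Away from the vertex the projection is, for a free action, a local isometry
   from R^n with its flat metric; so smoothness on the cone and the operators
   of its quotient metric are read off from the lift of a function to R^n. *)
Definition cone_lift (R : realType) (n : nat) (G : finOrthGroup R n)
    (v : cone G -> R) : 'cV[R]_n -> R :=
  fun x => v (\pi_(cone G) x).

Definition smooth_off_vertex (R : realType) (n : nat) (G : finOrthGroup R n)
    (v : cone G -> R) : Prop :=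
  smooth_on [set x | \pi_(cone G) x != vertex G] (cone_lift v).

(* The choice of the representative is immaterial: see
   cone_drift_laplacian_pi. *)
Definition cone_drift_laplacian (R : realType) (n : nat)
    (G : finOrthGroup R n) (f v : cone G -> R) (p : cone G) : R :=
  drift_laplacian (cone_lift f) (cone_lift v) (repr p).

Lemma pi_coneP (R : realType) (n : nat) (G : finOrthGroup R n)
    (x y : 'cV[R]_n) :
  \pi_(cone G) x = \pi_(cone G) y <-> exists2 A, fog_set G A & y = A *m x.
Proof.
split=> [/eqmodP/asboolP //|h]; by apply/eqmodP/asboolP.
Qed.

Lemma pi_vertex (R : realType) (n : nat) (G : finOrthGroup R n)
    (x : 'cV[R]_n) :
  (\pi_(cone G) x == vertex G) = (x == 0).
Proof.
apply/eqP/eqP => [/esym/pi_coneP[A _ ->]|->//]; by rewrite mulmx0.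
Qed.

Lemma dotE (R : realType) (n : nat) (x y : 'cV[R]_n) :
  dot x y = (x^T *m y) 0 0.
Proof. by rewrite mxE; apply: eq_bigr => i _; rewrite mxE. Qed.

Lemma dot_orthogonal (R : realType) (n : nat) (A : 'M[R]_n)
    (x y : 'cV[R]_n) :
  orthogonal_group R n A -> dot (A *m x) (A *m y) = dot x y.
Proof. by move=> oA; rewrite !dotE trmx_mul -mulmxA (mulmxA A^T) oA mul1mx. Qed.

Lemma cone_radius_pi (R : realType) (n : nat) (G : finOrthGroup R n)
    (x : 'cV[R]_n) :
  cone_radius (\pi_(cone G) x) = enorm x.
Proof.
rewrite /cone_radius /cone_dist (_ : image _ _ = [set enorm x]) ?inf1 //.
apply/seteqP; split=> [d [[a b] /= [/esym/pi_coneP[A GA ->]]]|d ->] /=.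
  move=> /eqP; rewrite pi_vertex => /eqP -> <-.
  by rewrite subr0 /enorm dot_orthogonal //; apply: fog_orth GA.
by exists (x, 0) => //=; rewrite subr0.
Qed.

Lemma derive_comp_mulmx (R : realType) (n : nat) (A : 'M[R]_n)
    (u : 'cV[R]_n -> R) (x w : 'cV[R]_n) :
  'D_w (u \o mulmx A) x = 'D_(A *m w) u (A *m x).
Proof.
rewrite /derive; set g := (X in lim (X @ _)); set g' := (X in _ = lim (X @ _)).
suff -> : g = g' by [].
by apply/funext => h; rewrite /g /g' /= mulmxDr -scalemxAr.
Qed.

Lemma derivable_comp_mulmx (R : realType) (n : nat) (A : 'M[R]_n)
    (u : 'cV[R]_n -> R) (x w : 'cV[R]_n) :
  derivable u (A *m x) (A *m w) -> derivable (u \o mulmx A) x w.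
Proof.
move=> du; rewrite /derivable.
rewrite (_ : (fun h : R => _) = (fun h => h^-1 *:
  ((u \o shift (A *m x)) (h *: (A *m w)) - u (A *m x)))); first exact: du.
by apply/funext => h /=; rewrite mulmxDr -scalemxAr.
Qed.

Lemma partial_comp_mulmx (R : realType) (n : nat) (A : 'M[R]_n)
    (u : 'cV[R]_n -> R) (x : 'cV[R]_n) (i : 'I_n) :
  differentiable u (A *m x) ->
  partial i (u \o mulmx A) x = \sum_j A j i * partial j u (A *m x).
Proof.
move=> du; rewrite /partial derive_comp_mulmx deriveE //.
rewrite (_ : A *m delta_mx i 0 = \sum_j A j i *: delta_mx j 0).
  rewrite linear_sum; apply: eq_bigr => j _.
  by rewrite linearZ /= deriveE.
rewrite -colE [LHS]matrix_sum_delta; apply: eq_bigr => j _.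
by rewrite big_ord1 mxE.
Qed.

Lemma near_neq0 (R : realType) (n : nat) (x : 'cV[R]_n) :
  x != 0 -> \forall y \near x, y != 0.
Proof.
move=> x0; near=> y; rewrite -normr_gt0.
have : `|x - y| < `|x| by near: y; apply: cvgr_dist_lt => //; rewrite normr_gt0.
by apply: contraTT; rewrite normr_gt0 negbK => /eqP ->; rewrite subr0 ltxx.
Unshelve. all: by end_near. Qed.

Lemma sum_orthogonal (R : realType) (n : nat) (A : 'M[R]_n)
    (c : 'I_n -> 'I_n -> R) :
  orthogonal_group R n A ->
  \sum_i \sum_j A j i * (\sum_k A k i * c k j) = \sum_j c j j.
Proof.
move=> oA; rewrite exchange_big /=; apply: eq_bigr => j _.
transitivity (\sum_k (A *m A^T) j k * c k j).
  under eq_bigr do rewrite mulr_sumr.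
  rewrite exchange_big /=; apply: eq_bigr => k _.
  rewrite mxE mulr_suml; apply: eq_bigr => i _.
  by rewrite !mxE mulrA.
rewrite (mulmx1C oA) (bigD1 j) //= big1 ?addr0 => [|k kj].
  by rewrite mxE eqxx mul1r.
by rewrite mxE eq_sym (negbTE kj) mul0r.
Qed.

Lemma laplacian_comp_orthogonal (R : realType) (n : nat) (A : 'M[R]_n)
    (u : 'cV[R]_n -> R) (x : 'cV[R]_n) :
  orthogonal_group R n A -> smooth_on [set y | y != 0] u -> x != 0 ->
  laplacian (u \o mulmx A) x = laplacian u (A *m x).
Proof.
move=> oA su x0; have Au := orthogonal_unitmx oA.
have A0 (y : 'cV[R]_n) : y != 0 -> A *m y != 0.
  by apply: contraNN => /eqP Ay; rewrite -(mulKmx Au y) Ay mulmx0.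
have d1 (y : 'cV[R]_n) : y != 0 -> differentiable u (A *m y).
  by move=> y0; exact: (su [::] (A *m y) (A0 _ y0)).
have d2 j (y : 'cV[R]_n) : y != 0 -> differentiable (partial j u) (A *m y).
  by move=> y0; exact: (su [:: j] (A *m y) (A0 _ y0)).
have E i : partial i (partial i (u \o mulmx A)) x =
    \sum_j A j i * (\sum_k A k i * partial k (partial j u) (A *m x)).
  transitivity (partial i (\sum_j A j i *: (partial j u \o mulmx A)) x).
    apply: near_eq_derive; near=> y.
    rewrite fct_sumE partial_comp_mulmx; last by apply: d1; near: y; exact: near_neq0.
    by [].
  rewrite /partial derive_sum; last first.
    move=> j; apply/derivableZ/derivable_comp_mulmx/diff_derivable/d2/x0.
  apply: eq_bigr => j _; rewrite deriveZ; last first.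
    exact/derivable_comp_mulmx/diff_derivable/d2/x0.
  by rewrite -[LHS]/(A j i * partial i (partial j u \o mulmx A) x) partial_comp_mulmx //; exact: d2.
rewrite /laplacian; transitivity (\sum_i \sum_j A j i *
    (\sum_k A k i * partial k (partial j u) (A *m x))).
  by apply: eq_bigr => i _; exact: E.
exact: (sum_orthogonal (fun k j => partial k (partial j u) (A *m x)) oA).
Unshelve. all: by end_near. Qed.

Lemma dot_grad_comp_orthogonal (R : realType) (n : nat) (A : 'M[R]_n)
    (f u : 'cV[R]_n -> R) (x : 'cV[R]_n) :
  orthogonal_group R n A ->
  differentiable f (A *m x) -> differentiable u (A *m x) ->
  dot (grad (f \o mulmx A) x) (grad (u \o mulmx A) x) =
  dot (grad f (A *m x)) (grad u (A *m x)).
Proof.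
move=> oA df du.
have E g : differentiable g (A *m x) ->
    grad (g \o mulmx A) x = A^T *m grad g (A *m x).
  move=> dg; apply/colP => i; rewrite !mxE partial_comp_mulmx //.
  by apply: eq_bigr => j _; rewrite !mxE.
rewrite !E // dot_orthogonal // /orthogonal_group /= trmxK.
exact: mulmx1C.
Qed.

Lemma cone_lift_comp_mulmx (R : realType) (n : nat) (G : finOrthGroup R n)
    (v : cone G -> R) (A : 'M[R]_n) :
  fog_set G A -> cone_lift v \o mulmx A = cone_lift v.
Proof.
move=> GA; apply/funext => x; rewrite /cone_lift /=; congr v.
by apply/esym/pi_coneP; exists A.
Qed.

Lemma cone_drift_laplacian_pi (R : realType) (n : nat) (G : finOrthGroup R n)
    (f v : cone G -> R) (x : 'cV[R]_n) :
  smooth_off_vertex f -> smooth_off_vertex v -> x != 0 ->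
  cone_drift_laplacian f v (\pi_(cone G) x) =
  drift_laplacian (cone_lift f) (cone_lift v) x.
Proof.
have UE : [set x | \pi_(cone G) x != vertex G] = [set x | x != 0].
  by apply/funext => y; rewrite /= pi_vertex.
rewrite /smooth_off_vertex UE => sf sv x0.
have : \pi_(cone G) x = \pi_(cone G) (repr (\pi_(cone G) x)) by rewrite reprK.
move=> /pi_coneP[A GA Ax]; have oA := fog_orth GA.
have Ax0 : A *m x != 0.
  by rewrite -(pi_vertex G) -Ax reprK pi_vertex.
rewrite /cone_drift_laplacian Ax /drift_laplacian.
rewrite -laplacian_comp_orthogonal // -dot_grad_comp_orthogonal //;
  [|exact: (sf [::])|exact: (sv [::])].
by rewrite !cone_lift_comp_mulmx.
Qed.

(* Main.v *)
Require Import Defs.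
From mathcomp Require Import all_boot all_order all_algebra.
From mathcomp Require Import all_classical all_reals all_analysis.
From mathcomp Require Import ring lra.

(** Pulled back to R^4, v is a positive solution u, away from the origin, of
    Lu = u with Lu = Delta u - (1/2) x . grad u, and u is bounded near infinity.
    One such solution is r^-2, and u is compared with the largest multiple of
    r^-2 below it.

    Since the zero order term has the good sign, a solution that is bounded
    below at infinity satisfies the minimum principle outside every sphere
    (exterior_minimum_principle); hence a bound u <= c r^-2 or u >= c r^-2 on
    the sphere of radius R propagates to all of |x| >= R. Let b be the infimum
    of r^2 u. By this principle, values of r^2 u close to b occur on every
    sphere of small enough radius R. For d > 0 the function
    w = u - (b - d) r^-2 is a positive solution, and r^2 w < 2d at some point
    of that sphere. The Harnack inequality on spheres (harnack_sphere), whose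
    constant C does not depend on R <= 1, gives r^2 w <= 2Cd on the whole
    sphere, and the comparison principle extends this to |x| >= R. Letting R
    and then d tend to 0 gives r^2 u <= b everywhere, so u = b r^-2
    (liouville_ou_eigen).

    The Harnack inequality comes from the scale invariant gradient estimate
    |grad log w| <= C / |x| for |x| <= 1 (dlog_sq_bound, gradient_estimate),
    integrated along chords of the sphere. The estimate is proved by
    Bernstein's method: the squared gradient Q of log w satisfies a Bochner
    identity (laplacian_dlog_sq) whose Hessian term controls Q^2, and the
    maximum principle is applied to the product of Q with the square of a
    quadratic cutoff. Everything rests on the second derivative test, the
    symmetry of second derivatives and the existence of extrema on compact
    sets. *)

Set Implicit Arguments.
Unset Strict Implicit.
Unset Printing Implicit Defensive.

Import Order.TTheory GRing.Theory Num.Theory.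
Import numFieldNormedType.Exports.

Local Open Scope classical_set_scope.
Local Open Scope ring_scope.
Local Open Scope quotient_scope.

(** * Calculus along a line *)

Lemma is_derive_line (R : realType) (V : normedModType R) (u : V -> R)
    (x e : V) (t : R) :
  derivable u (x + t *: e) e ->
  is_derive t 1 (fun s : R => u (x + s *: e)) ('D_e u (x + t *: e)).
Proof.
have E : (fun h : R => h^-1 *: (((fun s : R => u (x + s *: e)) \o shift t) (h
  *: 1)
      - u (x + t *: e))) =
    (fun h : R => h^-1 *: ((u \o shift (x + t *: e)) (h *: e) - u (x + t *:
      e))).
  apply/funext => h /=; congr (_ *: (u _ - _)).
  by rewrite /shift /= scalerDl [h *: 1]mulr1 addrCA.
move=> du; apply: DeriveDef; first by rewrite /derivable E.
by rewrite /derive E.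
Qed.

Lemma MVT_line (R : realType) (V : normedModType R) (u : V -> R) (x e : V)
    (t : R) :
  0 < t -> (forall s, 0 <= s <= t -> derivable u (x + s *: e) e) ->
  exists2 s, 0 < s < t & u (x + t *: e) - u x = 'D_e u (x + s *: e) * t.
Proof.
move=> t0 du.
pose phi (s : R) := u (x + s *: e); pose dphi s := 'D_e u (x + s *: e).
have D s : s \in `[0, t]%R -> is_derive s 1 phi (dphi s).
  by rewrite in_itv /= => st; apply/is_derive_line/du.
have Do s : s \in `]0, t[%R -> is_derive s 1 phi (dphi s).
  by move=> st; apply: D; move: st; rewrite !in_itv /= =>
    /andP[/ltW -> /ltW ->].
have phi_cont : {within `[0, t], continuous phi}.
  by apply: derivable_within_continuous => s /D[].
have [s] := MVT t0 Do phi_cont.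
rewrite /phi /dphi.
rewrite in_itv /= scale0r addr0 subr0 => st ->.
by exists s.
Qed.

Lemma near_line (R : realType) (V : normedModType R) (x e : V) (P : set V) :
  (\forall y \near x, P y) -> \forall t \near (0 : R), P (x + t *: e).
Proof.
move=> Px.
suff c : (fun t : R => x + t *: e) @ (0 : R) --> x by exact: c.
rewrite -[X in _ --> X]addr0 -(scale0r e).
by apply: cvgD; [exact: cvg_cst|apply: cvgZr_tmp; exact: cvg_id].
Qed.

(** If the second derivative c were negative, the first derivative, which
    vanishes at x, would be negative just after x, and the mean value theorem
    would give a smaller value of u there. *)
Lemma second_derivative_test (R : realType) (V : normedModType R) (u : V -> R)
    (x e : V) :
  (\forall y \near x, derivable u y e) -> derivable ('D_e u) x e ->
  (\forall y \near x, u x <= u y) ->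
  'D_e u x = 0 /\ 0 <= 'D_e ('D_e u) x.
Proof.
move=> du d2u umin.
have [r r0 Hr] : exists2 r : R, 0 < r & forall t : R, `|t| < r ->
    derivable u (x + t *: e) e /\ u x <= u (x + t *: e).
  have : \forall t \near (0 : R), derivable u (x + t *: e) e /\ u x <=
    u (x + t *: e).
    apply: (near_line _ (P := fun y => derivable u y e /\ u x <= u y)).
    by apply: filterI; [exact: du|exact: umin].
  move=> /nbhs_ballP[r /= r0 rP]; exists r; first exact: r0.
  by move=> t tr; apply: rP; rewrite /ball /= sub0r normrN.
have x0 : x = x + 0 *: e by rewrite scale0r addr0.
have D1 : 'D_e u x = 0.
  have [_ <-] : is_derive (0 : R) 1 (fun s : R => u (x + s *: e)) 0.
    apply: (@derive1_at_min _ _ (- r) r); first lra.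
    - move=> t; rewrite in_itv /= -ltr_norml => /Hr[h _].
      by case: (is_derive_line h).
    - by rewrite in_itv /=; lra.
    - by move=> t; rewrite in_itv /= -ltr_norml scale0r addr0 => /Hr[].
  have [] := @is_derive_line _ _ u x e 0.
    by rewrite -x0; exact: nbhs_singleton du.
  by rewrite -x0 => _ ->.
split=> //; rewrite leNgt; apply/negP => c0.
(* within -c of c the difference quotients of the first derivative stay
   negative *)
have /cvgrPdist_lt/(_ (- 'D_e ('D_e u) x)) : derivable ('D_e u) x e := d2u.
rewrite oppr_gt0 -/(derive ('D_e u) x e) D1 => /(_ c0).
rewrite near_withinE => /nbhs_ballP[s /= s0 sP].
pose t := Num.min s r / 2.
have st : 0 < t < s /\ t < r.
  rewrite /t; have : 0 < Num.min s r by rewrite lt_min s0.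
  have : Num.min s r <= s by rewrite ge_min lexx.
  have : Num.min s r <= r by rewrite ge_min lexx orbT.
  by move=> *; lra.
have [tp tr] := st; have /andP[t0 ts] := tp.
have [xi /andP[xi0 xit] E] : exists2 xi, 0 < xi < t &
    u (x + t *: e) - u x = 'D_e u (x + xi *: e) * t.
  apply: (MVT_line t0) => q /andP[q0 qt].
  by have [] : derivable u (x + q *: e) e /\ u x <= u (x + q *: e)
    by apply: Hr; rewrite ger0_norm //; lra.
have xi_s : ball (0 : R) s xi by rewrite /ball /= sub0r normrN gtr0_norm //;
  lra.
have := sP xi xi_s (lt0r_neq0 xi0).
rewrite subr0 ltr_norml opprK => /andP[Dxi _].
have {}Dxi : 'D_e u (x + xi *: e) < 0.
  have : xi^-1 *: 'D_e u (xi *: e + x) < 0 by lra.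
  by rewrite addrC /GRing.scale /= pmulr_rlt0 ?invr_gt0.
have [_] : derivable u (x + t *: e) e /\ u x <= u (x + t *: e).
  by apply: Hr; rewrite gtr0_norm.
by rewrite -subr_ge0 E nmulr_rge0 // leNgt t0.
Qed.

Lemma difference_quotient_translate (R : realType) (V : normedModType R)
    (u : V -> R) (x c e : V) :
  (fun h : R => h^-1 *: (((fun y => u (y + c)) \o shift x) (h *: e)
      - u (x + c))) =
  (fun h : R => h^-1 *: ((u \o shift (x + c)) (h *: e) - u (x + c))).
Proof. by apply/funext => h /=; rewrite addrA. Qed.

Lemma derive_translate (R : realType) (V : normedModType R) (u : V -> R)
    (x c e : V) :
  'D_e (fun y => u (y + c)) x = 'D_e u (x + c).
Proof. by rewrite /derive difference_quotient_translate. Qed.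

Lemma is_derive_translate (R : realType) (V : normedModType R) (u : V -> R)
    (x c e : V) :
  derivable u (x + c) e ->
  is_derive x e (fun y => u (y + c)) ('D_e u (x + c)).
Proof.
move=> du; apply: DeriveDef; last exact: derive_translate.
by rewrite /derivable difference_quotient_translate.
Qed.

(** The mean value theorem along a, applied to the increment of u along b, and
    then along b, applied to the derivative of u along a. *)
Lemma mixed_mean_value (R : realType) (V : normedModType R) (u : V -> R)
    (x a b : V) (t : R) :
  0 < t ->
  (forall s s', 0 <= s <= t -> 0 <= s' <= t ->
    derivable u (x + s *: a + s' *: b) a /\
    derivable ('D_a u) (x + s *: a + s' *: b) b) ->
  exists s s', [/\ 0 < s < t, 0 < s' < t &
    u (x + t *: a + t *: b) - u (x + t *: b) - (u (x + t *: a) - u x) =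
    'D_b ('D_a u) (x + s *: a + s' *: b) * t * t].
Proof.
move=> t0 du.
have dg s : 0 <= s <= t -> is_derive (x + s *: a) a
    (fun y => u (y + t *: b) - u y)
    ('D_a u (x + s *: a + t *: b) - 'D_a u (x + s *: a)).
  move=> st; apply: is_deriveB.
    by apply: is_derive_translate; apply: (du s t st _).1; rewrite lexx ltW.
  apply: derivableP; have := (du s 0 st _).1; rewrite scale0r addr0; apply.
  by rewrite lexx ltW.
have [|s st /= E] := @MVT_line R V (fun y => u (y + t *: b) - u y) x a t t0.
  by move=> s /dg[].
have s01 : 0 <= s <= t by case/andP: st => /ltW -> /ltW ->.
have [|s' s't E'] := @MVT_line R V ('D_a u) (x + s *: a) b t t0.
  by move=> s' s't; exact: (du s s' s01 s't).2.
exists s, s'; split => //.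
transitivity (u (x + t *: a + t *: b) - u (x + t *: a) - (u (x + t *: b) - u
  x)).
  by ring.
by rewrite E; have [_ ->] := dg s s01; rewrite E'.
Qed.

(** The second difference of u over a small square with sides along a and b is
    symmetric in a and b; by mixed_mean_value it is the area times a value of
    either mixed derivative, and both are continuous at x. *)
Lemma schwarz_mixed_derivatives (R : realType) (V : normedModType R)
    (u : V -> R) (x a b : V) :
  (\forall y \near x, [/\ derivable u y a, derivable u y b,
     derivable ('D_a u) y b & derivable ('D_b u) y a]) ->
  {for x, continuous ('D_b ('D_a u))} -> {for x, continuous ('D_a ('D_b u))} ->
  'D_b ('D_a u) x = 'D_a ('D_b u) x.
Proof.
move=> du cba cab; apply/eqP; rewrite -subr_eq0 -normr_eq0;
  apply/negPn/negP => d0.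
set d := `|_ - _| in d0.
have {}d0 : 0 < d by rewrite lt_neqAle eq_sym d0 normr_ge0.
have d2 : 0 < d / 2 by rewrite divr_gt0.
have : \forall y \near x, [/\ derivable u y a, derivable u y b,
     derivable ('D_a u) y b & derivable ('D_b u) y a] /\
     `|'D_b ('D_a u) x - 'D_b ('D_a u) y| < d / 2 /\
     `|'D_a ('D_b u) x - 'D_a ('D_b u) y| < d / 2.
  apply: filterI; first exact: du.
  by apply: filterI; [move/cvgrPdist_lt: cba|move/cvgrPdist_lt: cab]; exact.
move=> /nbhs_ballP[r /= r0 rP].
(* the square of side t stays in the ball where both derivatives vary by
   less than d / 2; the summand 1 covers the case a = b = 0 *)
pose t := r / (`|a| + `|b| + 1) / 2.
have ab0 : 0 < `|a| + `|b| + 1 by rewrite ltr_pwDr // addr_ge0.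
have t0 : 0 < t by rewrite /t divr_gt0 // divr_gt0.
have inr s s' : 0 <= s <= t -> 0 <= s' <= t -> ball x r (x + s *: a + s' *: b).
  move=> /andP[s0 st] /andP[s'0 s't].
  rewrite -ball_normE /= -addrA opprD addNKr normrN.
  apply: le_lt_trans (_ : t * (`|a| + `|b| + 1) < _); last first.
    by rewrite /t mulrAC divfK ?lt0r_neq0 //; lra.
  rewrite mulrDr mulr1 mulrDr -addrA; apply: le_trans (ler_normD _ _) _.
  rewrite !normrZ !ger0_norm // addrA ler_wpDr ?(ltW t0) //.
  by rewrite lerD // ler_wpM2r.
clearbody t.
have inQ s s' (h : 0 <= s <= t) (h' : 0 <= s' <= t) := rP _ (inr s s' h h').
have [s1 [s1' [s1t s1't E1]]] := @mixed_mean_value R V u x a b t t0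
  (fun s s' h h' => let: conj (And4 d1 d2 d3 d4) _ :=
    inQ s s' h h' in conj d1 d3).
have [s2 [s2' [s2t s2't E2]]] : exists s s', [/\ 0 < s < t, 0 < s' < t &
    u (x + t *: b + t *: a) - u (x + t *: a) - (u (x + t *: b) - u x) =
    'D_a ('D_b u) (x + s *: b + s' *: a) * t * t].
  apply: (mixed_mean_value t0) => s s' h h'.
  rewrite (addrAC x (s *: b)); have [[_ d2' _ d4] _] := inQ s' s h' h.
  exact: conj d2' d4.
have W s : 0 < s < t -> 0 <= s <= t by move=> /andP[/ltW -> /ltW ->].
have [_ [B1 _]] := inQ _ _ (W _ s1t) (W _ s1't).
have [_ [_ B2]] := inQ _ _ (W _ s2't) (W _ s2t).
have E : 'D_b ('D_a u) (x + s1 *: a + s1' *: b) =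
    'D_a ('D_b u) (x + s2' *: a + s2 *: b).
  apply: (mulIf (lt0r_neq0 t0)); apply: (mulIf (lt0r_neq0 t0)).
  rewrite -[LHS]E1 (addrAC x (s2' *: a)) -[RHS]E2 (addrAC x (t *: a)).
  move: (u _) (u _) (u _) (u _) => p q r' s'; ring.
rewrite E in B1; rewrite distrC in B2.
have := le_lt_trans (ler_distD _ _ _) (ltrD B1 B2).
by rewrite -splitr ltxx.
Qed.

(** * Smooth functions on an open set *)

(** Identities such as the product rule for partial derivatives hold only on an
    open set, so differentiability has to be transported along local equality
    before higher derivatives can be taken. *)
Lemma near_eq_differentiable (R : realType) (V W : normedModType R)
    (f g : V -> W) (x : V) :
  (\forall y \near x, f y = g y) -> differentiable f x -> differentiable g x.
Proof.
move=> fg df.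
have gx : g \o shift x = cst (g x) + 'd f x +o_ 0 id.
  have /eqaddoP fx := diff_locally df.
  apply/eqaddoP => e e0; near=> y.
  have -> : (g \o shift x - (cst (g x) + 'd f x)) y =
      (f \o shift x - (cst (f x) + 'd f x)) y.
    rewrite /= (nbhs_singleton fg) !fctE /=; congr (_ - _).
    apply/esym; near: y; move/nbhs_ballP: fg => [r /= r0 rP].
    apply/nbhs_ballP; exists r => //= y; rewrite -!ball_normE /= sub0r normrN
      => yr.
    by apply: rP; rewrite -ball_normE /= opprD addrCA subrr addr0 normrN.
  by near: y; exact: fx.
have dg : 'd g x = 'd f x :> (V -> W).
  by apply: diff_unique gx; exact: diff_continuous.
by apply/diff_locallyP; rewrite dg; split => //; exact: diff_continuous.
Unshelve. all: by end_near. Qed.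

Section SmoothAlgebra.
Context {R : realType} {n : nat} (U : set 'cV[R]_n).
Hypothesis oU : open U.
Implicit Types u v : 'cV[R]_n -> R.

Lemma near_open x : U x -> \forall y \near x, U y.
Proof. by move=> Ux; exact: open_nbhs_nbhs. Qed.

Lemma partial_eq_on u v i :
  (forall x, U x -> u x = v x) ->
  forall x, U x -> partial i u x = partial i v x.
Proof.
by move=> uv x Ux; apply: near_eq_derive; apply: filterS (near_open Ux) =>
  y /uv.
Qed.

Lemma smooth_on_diff u x : smooth_on U u -> U x -> differentiable u x.
Proof. by move=> su Ux; exact: (su [::]). Qed.

Lemma smooth_on_derivable u x e : smooth_on U u -> U x -> derivable u x e.
Proof. by move=> su Ux; exact/diff_derivable/smooth_on_diff. Qed.

Lemma smooth_on_partial u i : smooth_on U u -> smooth_on U (partial i u).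
Proof. by move=> su s x Ux; rewrite -foldr_rcons; exact: su. Qed.

Lemma smooth_on_eq u v :
  (forall x, U x -> u x = v x) -> smooth_on U u -> smooth_on U v.
Proof.
move=> uv su s x Ux; apply: near_eq_differentiable (su s x Ux).
apply: filterS (near_open Ux) => {x Ux}.
by elim: s => [|i s IH] /=; [exact: uv|exact: partial_eq_on].
Qed.

(** Coinduction, in place of an induction on the list of derivatives for each
    closure property. The derivative is only required to agree on U with a
    member of the class, since differentiation rules are available only
    there. *)
Lemma smooth_on_coind (P : ('cV[R]_n -> R) -> Prop) :
  (forall u, P u -> forall x, U x -> differentiable u x) ->
  (forall u i, P u -> exists2 w, P w & forall x, U x -> partial i u x = w x) ->
  forall u, P u -> smooth_on U u.
Proof.
move=> Pd Pp u Pu s; elim/last_ind: s u Pu => [|s i IH] u Pu x Ux;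
  first exact: Pd Pu x Ux.
rewrite foldr_rcons; have [w Pw uw] := Pp u i Pu.
apply: near_eq_differentiable (IH w Pw x Ux).
apply: filterS (near_open Ux) => {x Ux}.
elim: {IH} s => [|j s IH] x Ux /=; first by rewrite uw.
by apply: partial_eq_on x Ux => y Uy; rewrite IH.
Qed.

Lemma partialD u v i x : differentiable u x -> differentiable v x ->
  partial i (fun y => u y + v y) x = partial i u x + partial i v x.
Proof.
by move=> du dv; apply: (deriveD (diff_derivable du) (diff_derivable dv)).
Qed.

Lemma partialM u v i x : differentiable u x -> differentiable v x ->
  partial i (fun y => u y * v y) x = u x * partial i v x + v x * partial i u x.
Proof.
by move=> du dv; apply: (deriveM (diff_derivable du) (diff_derivable dv)).
Qed.

Lemma partialV u i x : differentiable u x -> u x != 0 ->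
  partial i (fun y => (u y)^-1) x = - ((u x)^-1 * (u x)^-1 * partial i u x).
Proof.
move=> du u0; rewrite /partial (deriveV u0 (diff_derivable du)).
by rewrite /GRing.scale /= expr2 invfM mulNr.
Qed.

Lemma partial_cst (c : R) i x : partial i (cst c : 'cV[R]_n -> R) x = 0.
Proof. exact: derive_cst. Qed.

Lemma smooth_on_cst (c : R) : smooth_on U (cst c : 'cV[R]_n -> R).
Proof.
apply: (@smooth_on_coind (fun u => exists c : R, u = cst c)); last by exists c.
  by move=> _ [d ->] x _; exact: differentiable_cst.
move=> _ i [d ->]; exists (cst 0); first by exists 0.
by move=> x _; exact: partial_cst.
Qed.

(** The identity map is its own derivative; this is its j-th entry. *)
Lemma partial_coord i j x :
  partial i (fun y : 'cV[R]_n => y j 0) x = (i == j)%:R.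
Proof.
have /matrixP/(_ j 0) := @derive_mx _ _ _ _ id x (delta_mx i 0 : 'cV[R]_n)
  (@derivable_id _ _ _ _).
by rewrite derive_id !mxE eqxx andbT eq_sym => ->.
Qed.

Lemma smooth_on_coord j : smooth_on U (fun y : 'cV[R]_n => y j 0).
Proof.
apply: (@smooth_on_coind (fun u => (exists c : R, u = cst c) \/
  u = (fun y : 'cV[R]_n => y j 0))); last by right.
  by move=> _ [[d ->]|->] x _; [exact: differentiable_cst|
    exact: differentiable_coord].
move=> _ i [[d ->]|->].
  by exists (cst 0); [left; exists 0|move=> x _; exact: partial_cst].
by exists (cst (i == j)%:R); [left; eexists|move=> x _; exact: partial_coord].
Qed.

(** The sums, products and inverses of smooth functions: by the rules of
    differentiation this class is stable under partial derivatives, which is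
    what smooth_on_coind needs. Smoothness of a product could not be shown for
    products alone, since their derivatives are sums of products. *)
Inductive smooth_expr : ('cV[R]_n -> R) -> Prop :=
| smooth_expr_on u : smooth_on U u -> smooth_expr u
| smooth_exprD u v : smooth_expr u -> smooth_expr v ->
    smooth_expr (fun x => u x + v x)
| smooth_exprM u v : smooth_expr u -> smooth_expr v ->
    smooth_expr (fun x => u x * v x)
| smooth_exprV u : (forall x, U x -> u x != 0) -> smooth_expr u ->
    smooth_expr (fun x => (u x)^-1).

Lemma smooth_expr_smooth u : smooth_expr u -> smooth_on U u.
Proof.
have D w : smooth_expr w -> forall x, U x -> differentiable w x.
  elim=> {w} [w sw x|u1 u2 _ d1 _ d2 x Ux|u1 u2 _ d1 _ d2 x Ux|u1 u0 _ d1 x Ux].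
  - exact: smooth_on_diff.
  - exact: differentiableD (d1 x Ux) (d2 x Ux).
  - exact: differentiableM (d1 x Ux) (d2 x Ux).
  - exact: differentiableV (d1 x Ux) (u0 x Ux).
move: u; apply: smooth_on_coind => // u i; elim=> {u}.
- move=> u su; exists (partial i u) => //.
  exact/smooth_expr_on/smooth_on_partial.
- move=> u1 u2 s1 [w1 sw1 E1] s2 [w2 sw2 E2].
  exists (fun x => w1 x + w2 x); first exact: smooth_exprD.
  by move=> x Ux; rewrite partialD ?E1 ?E2 //; exact: D.
- move=> u1 u2 s1 [w1 sw1 E1] s2 [w2 sw2 E2].
  exists (fun x => u1 x * w2 x + u2 x * w1 x).
    by apply: smooth_exprD; exact: smooth_exprM.
  by move=> x Ux; rewrite partialM ?E1 ?E2 //; exact: D.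
- move=> u1 u0 s1 [w1 sw1 E1].
  exists (fun x => cst (-1) x * ((u1 x)^-1 * (u1 x)^-1 * w1 x)).
    apply: smooth_exprM; first exact/smooth_expr_on/smooth_on_cst.
    by do 2! [apply: smooth_exprM => //]; exact: smooth_exprV.
  by move=> x Ux; rewrite partialV ?E1 /= ?mulN1r //; [exact: D|exact: u0].
Qed.

Lemma smooth_onD u v : smooth_on U u -> smooth_on U v ->
  smooth_on U (fun x => u x + v x).
Proof.
by move=> su sv; apply/smooth_expr_smooth/smooth_exprD; exact: smooth_expr_on.
Qed.

Lemma smooth_onM u v : smooth_on U u -> smooth_on U v ->
  smooth_on U (fun x => u x * v x).
Proof.
by move=> su sv; apply/smooth_expr_smooth/smooth_exprM; exact: smooth_expr_on.
Qed.

Lemma smooth_onV u : (forall x, U x -> u x != 0) -> smooth_on U u ->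
  smooth_on U (fun x => (u x)^-1).
Proof.
by move=> u0 su; apply/smooth_expr_smooth/smooth_exprV => //;
  exact: smooth_expr_on.
Qed.

Lemma smooth_on_sum m (u : 'I_m -> 'cV[R]_n -> R) :
  (forall i, smooth_on U (u i)) -> smooth_on U (fun x => \sum_i u i x).
Proof.
elim: m u => [|m IH] u su.
  by under eq_fun do rewrite big_ord0; exact: smooth_on_cst.
under eq_fun do rewrite big_ord_recl.
by apply: smooth_onD => //; apply: IH => i; exact: su.
Qed.

Lemma partial_sum m (u : 'I_m -> 'cV[R]_n -> R) i x :
  (forall j, differentiable (u j) x) ->
  partial i (fun y => \sum_j u j y) x = \sum_j partial i (u j) x.
Proof.
move=> du; rewrite /partial -derive_sum; last by move=> j;
  exact: diff_derivable.
by congr (derive _ x _); apply/funext => y; rewrite fct_sumE.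
Qed.

Lemma partialC u i j x : smooth_on U u -> U x ->
  partial i (partial j u) x = partial j (partial i u) x.
Proof.
move=> su Ux; apply: schwarz_mixed_derivatives.
- apply: filterS (near_open Ux) => y Uy.
  by split; apply: smooth_on_derivable => //; exact: smooth_on_partial.
- by apply/differentiable_continuous/smooth_on_diff => //;
    do 2! apply: smooth_on_partial.
- by apply/differentiable_continuous/smooth_on_diff => //;
    do 2! apply: smooth_on_partial.
Qed.

End SmoothAlgebra.

Lemma derive_partial (R : realType) (n : nat) (u : 'cV[R]_n -> R)
    (x e : 'cV[R]_n) :
  differentiable u x -> 'D_e u x = \sum_i e i 0 * partial i u x.
Proof.
move=> du; rewrite deriveE //.
rewrite {1}(_ : e = \sum_i e i 0 *: delta_mx i 0); last first.
  by rewrite [LHS]matrix_sum_delta; apply: eq_bigr => i _; rewrite big_ord1.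
rewrite linear_sum; apply: eq_bigr => i _.
by rewrite linearZ /= /partial deriveE.
Qed.

(** * Euclidean space *)

Lemma dot_ge0 (R : realType) (n : nat) (x : 'cV[R]_n) : 0 <= dot x x.
Proof. by apply: sumr_ge0 => i _; rewrite -expr2 sqr_ge0. Qed.

Lemma dot_eq0 (R : realType) (n : nat) (x : 'cV[R]_n) :
  (dot x x == 0) = (x == 0).
Proof.
apply/eqP/eqP => [d0|->]; last by rewrite /dot big1 // => i _;
  rewrite mxE mul0r.
apply/colP => i; rewrite mxE; apply/eqP; rewrite -sqrf_eq0 expr2.
by apply/eqP; apply: (psumr_eq0P _ d0) => // j _; rewrite -expr2 sqr_ge0.
Qed.

Lemma dot_gt0 (R : realType) (n : nat) (x : 'cV[R]_n) :
  (0 < dot x x) = (x != 0).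
Proof. by rewrite lt_neqAle eq_sym dot_eq0 dot_ge0 andbT. Qed.

Lemma coord_le_dot (R : realType) (n : nat) (x : 'cV[R]_n) i :
  x i 0 ^+ 2 <= dot x x.
Proof.
rewrite /dot (bigD1 i) //= expr2 lerDl.
by apply: sumr_ge0 => j _; rewrite -expr2 sqr_ge0.
Qed.

Lemma dotC (R : realType) (n : nat) (x y : 'cV[R]_n) : dot x y = dot y x.
Proof. by apply: eq_bigr => i _; rewrite mulrC. Qed.

Lemma dotNr (R : realType) (n : nat) (x y : 'cV[R]_n) : dot x (- y) = - dot x y.
Proof. by rewrite /dot -sumrN; apply: eq_bigr => i _; rewrite !mxE mulrN. Qed.

Lemma dot_segment (R : realType) (n : nat) (x y : 'cV[R]_n) (t : R) :
  dot (x + t *: (y - x)) (x + t *: (y - x)) =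
  (1 - t) ^+ 2 * dot x x + 2 * t * (1 - t) * dot x y + t ^+ 2 * dot y y.
Proof.
rewrite /dot !mulr_sumr -!big_split; apply: eq_bigr => i _.
by rewrite !mxE /=; ring.
Qed.

Lemma dot_sub (R : realType) (n : nat) (x y : 'cV[R]_n) :
  dot (y - x) (y - x) = dot x x - 2 * dot x y + dot y y.
Proof.
rewrite /dot !mulr_sumr -sumrN -!big_split; apply: eq_bigr => i _.
by rewrite !mxE /=; ring.
Qed.

Lemma enorm_sqr (R : realType) (n : nat)
    (x : 'cV[R]_n) : enorm x ^+ 2 = dot x x.
Proof. by rewrite sqr_sqrtr // dot_ge0. Qed.

(** Heine-Borel for column vectors, by transposition from row vectors. *)
Lemma compact_bounded_coords (R : realType) (n : nat) (A : set 'cV[R]_n)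
    (M : R) :
  closed A -> (forall x i, A x -> `|x i 0| <= M) -> compact A.
Proof.
move=> cA bA.
pose T (y : 'rV[R]_n) : 'cV[R]_n := y^T.
have cT : continuous T.
  move=> y B /nbhs_ballP[e /= e0 eB]; apply/nbhs_ballP;
    exists e => //= z [_ yz].
  by apply: eB; split=> // i j; rewrite /T !mxE.
have -> : A = T @` (T @^-1` A).
  by apply/seteqP; split => [x Ax|_ [y Ay <-]] //; exists x^T;
    rewrite /T /= trmxK.
apply: continuous_compact; first exact: continuous_subspaceT.
apply: bounded_closed_compact; last by apply: closed_comp => // y _; exact: cT.
exists `|M|; split; first exact: num_real.
move=> K MK y Ay; rewrite /= [leLHS]/Num.Def.normr /= mx_normrE.
have M0 i : `|y 0 i| <= M by have := bA _ i Ay; rewrite /T mxE.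
apply/bigmax_leP; split => [|[i j] _ /=]; last first.
  by rewrite (ord1 i) (le_trans (M0 j)) // (le_trans (ler_norm _)) // ltW.
by rewrite (le_trans (normr_ge0 M)) // ltW.
Qed.

(** * The Laplacian *)

Lemma smooth_on_dot (R : realType) (n : nat) (U : set 'cV[R]_n) :
  open U -> smooth_on U (fun x => dot x x).
Proof.
by move=> oU; apply: smooth_on_sum => // i; apply: smooth_onM => //;
  exact: smooth_on_coord.
Qed.

Lemma differentiable_dot (R : realType) (n : nat) (x : 'cV[R]_n) :
  differentiable (fun y => dot y y) x.
Proof. exact: (smooth_on_diff (smooth_on_dot openT)). Qed.

Lemma partial_dot (R : realType) (n : nat) (x : 'cV[R]_n) i :
  partial i (fun y => dot y y) x = 2 * x i 0.
Proof.
rewrite /dot partial_sum; last first.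
  by move=> j; apply: differentiableM; exact: differentiable_coord.
rewrite (bigD1 i) //= big1 => [|j ji].
  rewrite partialM ?partial_coord; try exact: differentiable_coord.
  by rewrite eqxx /=; ring.
rewrite partialM ?partial_coord; try exact: differentiable_coord.
by rewrite eq_sym (negbTE ji) /=; ring.
Qed.

Lemma open_neq0 (R : realType) (n : nat) : open [set x : 'cV[R]_n | x != 0].
Proof. by rewrite openE => x /= x0; exact: near_neq0. Qed.

Lemma continuous_dot (R : realType) (n : nat) :
  continuous (fun x : 'cV[R]_n => dot x x).
Proof. by move=> x; apply/differentiable_continuous/differentiable_dot. Qed.

Lemma laplacian_dot (R : realType) (n : nat) (x : 'cV[R]_n) :
  laplacian (fun y => dot y y) x = (2 * n)%:R.
Proof.
rewrite /laplacian (eq_bigr (fun=> 2)) => [|i _].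
  by rewrite sumr_const card_ord natrM mulr_natr.
rewrite (_ : partial i (fun y => dot y y) = (fun y => cst 2 y * y i 0));
  last first.
  by apply/funext => y; rewrite partial_dot.
rewrite partialM ?partial_cst ?partial_coord; first by rewrite eqxx /=; ring.
  exact: differentiable_cst.
exact: differentiable_coord.
Qed.

Section Laplacian.
Context {R : realType} {n : nat} (U : set 'cV[R]_n).
Hypothesis oU : open U.
Implicit Types u v : 'cV[R]_n -> R.

Lemma partial2D u v i x : smooth_on U u -> smooth_on U v -> U x ->
  partial i (partial i (fun y => u y + v y)) x =
  partial i (partial i u) x + partial i (partial i v) x.
Proof.
move=> su sv Ux.
rewrite (partial_eq_on oU (v := fun y => partial i u y + partial i v y)) //.
  by rewrite partialD //; apply: (smooth_on_diff _ Ux);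
    exact: smooth_on_partial.
by move=> y Uy; rewrite partialD //; apply: smooth_on_diff Uy.
Qed.

Lemma partial2M u v i x : smooth_on U u -> smooth_on U v -> U x ->
  partial i (partial i (fun y => u y * v y)) x =
  u x * partial i (partial i v) x + 2 * (partial i u x * partial i v x) +
  v x * partial i (partial i u) x.
Proof.
move=> su sv Ux.
have [siu siv] := (smooth_on_partial i su, smooth_on_partial i sv).
rewrite (partial_eq_on oU (v := fun y => u y * partial i v y + v y * partial i
  u y)) //.
  rewrite (partialD _ (smooth_on_diff (smooth_onM oU su siv) Ux)
    (smooth_on_diff (smooth_onM oU sv siu) Ux)).
  rewrite (partialM _ (smooth_on_diff su Ux) (smooth_on_diff siv Ux)).
  rewrite (partialM _ (smooth_on_diff sv Ux) (smooth_on_diff siu Ux)).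
  move: (partial i (partial i v) x) (partial i (partial i u) x) => p q.
  by move: (partial i u x) (partial i v x) => r s; ring.
by move=> y Uy; rewrite partialM //; apply: smooth_on_diff Uy.
Qed.

Lemma laplacianD u v x : smooth_on U u -> smooth_on U v -> U x ->
  laplacian (fun y => u y + v y) x = laplacian u x + laplacian v x.
Proof.
by move=> su sv Ux; rewrite -big_split; apply: eq_bigr => i _; exact: partial2D.
Qed.

Lemma laplacianM u v x : smooth_on U u -> smooth_on U v -> U x ->
  laplacian (fun y => u y * v y) x =
  u x * laplacian v x + 2 * (\sum_i partial i u x * partial i v x) +
  v x * laplacian u x.
Proof.
move=> su sv Ux; rewrite /laplacian !mulr_sumr -!big_split /=.
by apply: eq_bigr => i _; exact: partial2M.
Qed.

Lemma laplacian_cst (c : R) x : laplacian (cst c : 'cV[R]_n -> R) x = 0.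
Proof.
rewrite /laplacian big1 // => i _.
rewrite (_ : partial i (cst c : 'cV[R]_n -> R) = cst 0) ?partial_cst //.
by apply/funext => y; rewrite partial_cst.
Qed.

Lemma laplacianZ (c : R) u x : smooth_on U u -> U x ->
  laplacian (fun y => c * u y) x = c * laplacian u x.
Proof.
move=> su Ux; have := laplacianM (smooth_on_cst oU c) su Ux.
rewrite laplacian_cst mulr0 addr0 /= => ->.
by rewrite big1 ?mulr0 ?addr0 // => i _; rewrite partial_cst mul0r.
Qed.

Lemma laplacian_at_min u x : smooth_on U u -> U x ->
  (\forall y \near x, u x <= u y) ->
  (forall i, partial i u x = 0) /\ 0 <= laplacian u x.
Proof.
move=> su Ux umin.
have T i : partial i u x = 0 /\ 0 <= partial i (partial i u) x.
  apply: second_derivative_test => //.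
    by apply: filterS (near_open oU Ux) => y Uy;
      exact: smooth_on_derivable su Uy.
  by apply: smooth_on_derivable Ux; exact: smooth_on_partial.
by split=> [i|]; [exact: (T i).1|apply: sumr_ge0 => i _; exact: (T i).2].
Qed.

Lemma laplacian_sum m (u : 'I_m -> 'cV[R]_n -> R) x :
  (forall j, smooth_on U (u j)) -> U x ->
  laplacian (fun y => \sum_j u j y) x = \sum_j laplacian (u j) x.
Proof.
move=> su Ux; rewrite /laplacian exchange_big /=; apply: eq_bigr => i _.
rewrite (partial_eq_on oU (v := fun y => \sum_j partial i (u j) y)) //.
  by apply: partial_sum => j; exact: smooth_on_diff (smooth_on_partial i (su
    j)) Ux.
by move=> y Uy; apply: partial_sum => j; exact: smooth_on_diff (su j) Uy.
Qed.

End Laplacian.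

Lemma partial_translate (R : realType) (n : nat) (u : 'cV[R]_n -> R) c i x :
  partial i (fun y => u (y - c)) x = partial i u (x - c).
Proof. exact: derive_translate. Qed.

Lemma laplacian_translate (R : realType) (n : nat) (u : 'cV[R]_n -> R) c x :
  laplacian (fun y => u (y - c)) x = laplacian u (x - c).
Proof.
apply: eq_bigr => i _; rewrite -[RHS]partial_translate; congr (partial i _ x).
by apply/funext => y; rewrite partial_translate.
Qed.

(** * The eigenvalue equation and the exterior minimum principle *)

(** The drifted Laplacian of the weight |x|^2 / 4, that is, an
    Ornstein-Uhlenbeck operator. *)
Definition ou_op (R : realType) (n : nat) (u : 'cV[R]_n -> R)
    (x : 'cV[R]_n) : R :=
  laplacian u x - 2^-1 * \sum_i x i 0 * partial i u x.

Definition ou_eigen (R : realType) (n : nat) (u : 'cV[R]_n -> R) : Prop :=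
  smooth_on [set x | x != 0] u /\ forall x, x != 0 -> ou_op u x = u x.

Lemma ou_eigen_lincomb (R : realType) (n : nat) (a b : R)
    (u v : 'cV[R]_n -> R) :
  ou_eigen u -> ou_eigen v -> ou_eigen (fun x => a * u x + b * v x).
Proof.
move=> [su Eu] [sv Ev]; have o := @open_neq0 R n.
have sa : smooth_on [set x | x != 0] (fun x => a * u x).
  exact: (smooth_onM o (smooth_on_cst o _) su).
have sb : smooth_on [set x | x != 0] (fun x => b * v x).
  exact: (smooth_onM o (smooth_on_cst o _) sv).
split; first exact: (smooth_onD o sa sb).
move=> x x0; rewrite -(Eu x x0) -(Ev x x0) /ou_op (laplacianD o) //.
rewrite !(laplacianZ o) // !mulrBr !(mulrCA _ 2^-1).
rewrite [RHS]addrACA; congr (_ + _).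
rewrite -opprD -mulrDr; congr (- (_ * _)).
rewrite !mulr_sumr -big_split; apply: eq_bigr => i _ /=.
have dc (c : R) : differentiable (cst c : 'cV[R]_n -> R) x
  by exact: differentiable_cst.
have du := smooth_on_diff su x0; have dv := smooth_on_diff sv x0.
rewrite (partialD _ (smooth_on_diff sa x0) (smooth_on_diff sb x0)).
by rewrite !(partialM _ (dc _)) // !partial_cst /=; ring.
Qed.

(** Dimension 4 enters here: r^-2 is the fundamental solution of the Laplacian,
    and it is homogeneous of degree -2, which the drift turns into the
    eigenvalue 1. *)
Lemma ou_eigen_inv_dot (R : realType) :
  ou_eigen (fun x : 'cV[R]_4 => (dot x x)^-1).
Proof.
have o := @open_neq0 R 4.
have sd := smooth_on_dot o.
have d0 (x : 'cV[R]_4) : x != 0 -> dot x x != 0 by rewrite dot_eq0.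
have si : smooth_on [set x : 'cV[R]_4 | x != 0] (fun x => (dot x x)^-1).
  exact: smooth_onV.
split=> // x x0; have D0 := d0 x x0.
have pi i : partial i (fun y : 'cV[R]_4 => (dot y y)^-1) x =
    - 2 * (dot x x)^-1 ^+ 2 * x i 0.
  by rewrite partialV //; [rewrite partial_dot expr2;
    ring|exact: differentiable_dot].
have L : laplacian (fun y : 'cV[R]_4 => (dot y y)^-1) x = 0.
  (* harmonicity is read off from the Laplacian of the constant r^2 * r^-2 *)
  have := laplacianM o sd si x0; rewrite laplacian_dot.
  have -> : laplacian (fun y : 'cV[R]_4 => dot y y * (dot y y)^-1) x = 0.
    rewrite -(laplacian_cst 1 x); apply: eq_bigr => i _.
    apply: (partial_eq_on o) x0 => y y0; apply: (partial_eq_on o) y0 => z z0.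
    by rewrite /= divff // d0.
  have -> : \sum_i partial i (fun y : 'cV[R]_4 => dot y y) x *
      partial i (fun y : 'cV[R]_4 => (dot y y)^-1) x = - 4 * (dot x x)^-1.
    transitivity (- 4 * (dot x x)^-1 ^+ 2 * dot x x); last by field.
    rewrite [X in _ = _ * X]/dot mulr_sumr; apply: eq_bigr => i _.
    by rewrite partial_dot pi; ring.
  have -> : (2 * 4)%N%:R = 8 :> R by [].
  move=> E; apply: (mulfI D0); rewrite mulr0.
  by move: E; set L := laplacian _ _; set q := (dot x x)^-1; lra.
rewrite /ou_op L sub0r.
have -> : \sum_i x i 0 * partial i (fun y : 'cV[R]_4 => (dot y y)^-1) x =
    - 2 * (dot x x)^-1 ^+ 2 * dot x x.
  by rewrite [X in _ = _ * X]/dot mulr_sumr; apply: eq_bigr => i _; rewrite pi;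
    ring.
by field.
Qed.

(** The function |x|^2 + 2n + 1 is a strict supersolution that grows at
    infinity. A small multiple of it, added to w, makes the sum positive there,
    so that a negative value would force an interior minimum, where the equation
    fails. *)
Lemma exterior_minimum_principle (R : realType) (n : nat) (w : 'cV[R]_n -> R)
    (a M K : R) :
  0 < a -> ou_eigen w -> (forall x, dot x x = a -> 0 <= w x) ->
  (forall x, K <= dot x x -> M <= w x) ->
  forall x, a <= dot x x -> 0 <= w x.
Proof.
move=> a0 [sw Ew] wa wM x1 ax1; rewrite leNgt; apply/negP => wx1.
have o := @open_neq0 R n.
pose k : R := (2 * n)%:R + 1.
have k0 : 0 < k by rewrite /k ltr_wpDl.
have d1 := dot_ge0 x1.
pose e := - w x1 / (2 * (dot x1 x1 + k)).
have e0 : 0 < e by rewrite /e divr_gt0 ?oppr_gt0 // mulr_gt0 // ltr_wpDl.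
pose z := fun x : 'cV[R]_n => w x + e * (dot x x + k).
have zx1 : z x1 < 0.
  rewrite /z /e; set D := dot x1 x1 + k.
  have D0 : D != 0 by rewrite gt_eqF // /D ltr_wpDl.
  by rewrite (_ : - w x1 / (2 * D) * D = - w x1 / 2); [lra|field].
pose b := `|M| / e + `|K| + dot x1 x1.
have zb x : b <= dot x x -> 0 <= z x.
  move=> bx; have Me : 0 <= `|M| / e by rewrite divr_ge0 // ltW.
  have Kx : K <= dot x x by have := ler_norm K; rewrite /b in bx; lra.
  have : `|M| <= e * dot x x.
    rewrite -ler_pdivrMl // mulrC; apply: le_trans bx.
    by rewrite /b -addrA lerDl addr_ge0.
  have := wM x Kx; have := ler_norm (- M); rewrite normrN /z mulrDr.
  have : 0 < e * k by rewrite mulr_gt0.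
  lra.
have za x : dot x x = a -> 0 <= z x.
  move=> xa; rewrite /z xa addr_ge0 ?wa // mulr_ge0 ?(ltW e0) // addr_ge0 //;
    exact: ltW.
pose A := [set x : 'cV[R]_n | a <= dot x x] `&` [set x | dot x x <= b].
have A1 : A x1.
  by split=> //=; rewrite /b lerDr addr_ge0 // divr_ge0 // ltW.
have cA : compact A.
  apply: (@compact_bounded_coords _ _ _ (b + 1)).
    apply: closedI.
      apply: (@closed_comp _ _ (fun x : 'cV[R]_n => dot x x) [set y | a <= y]).
        by move=> x _; exact: continuous_dot.
      exact: closed_ge.
    apply: (@closed_comp _ _ (fun x : 'cV[R]_n => dot x x) [set y | y <= b]).
      by move=> x _; exact: continuous_dot.
    exact: closed_le.
  move=> x i [_ /= xb]; have := coord_le_dot x i;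
    rewrite -real_normK ?num_real //.
  have := normr_ge0 (x i 0); move: `|x i 0| => y y0 yx; nra.
have A0 x : A x -> x != 0.
  by move=> [/= ax _]; rewrite -dot_gt0; exact: lt_le_trans ax.
have sz : smooth_on [set x | x != 0] z.
  apply: smooth_onD => //; apply: smooth_onM; [by []|exact: smooth_on_cst|].
  by apply: smooth_onD => //; [exact: smooth_on_dot|exact: smooth_on_cst].
have [||y yA ymin] := compact_EVT_min (f := z) _ cA.
- by exists x1.
- apply: continuous_in_subspaceT => x /set_mem Ax.
  by apply/differentiable_continuous/(smooth_on_diff sz)/A0.
move/set_mem: yA => Ay; have y0 := A0 _ Ay; have [/= ay yb] := Ay.
have zy : z y < 0 by apply: le_lt_trans (ymin x1 _) zx1; exact/mem_set.
have {}ay : a < dot y y.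
  by rewrite lt_neqAle ay andbT; apply/negP => /eqP/esym/za; rewrite leNgt zy.
have {}yb : dot y y < b by rewrite ltNge; apply/negP => /zb; rewrite leNgt zy.
have [|p0 L0] := laplacian_at_min o sz y0.
  have nA : \forall x \near y, a < dot x x /\ dot x x < b.
    have cy := @continuous_dot R n y.
    by apply: filterI; [move/cvgr_gt: cy; exact|
      move/cvgr_lt: cy; exact].
  apply: filterS nA => x [ax xb]; apply: ymin; apply/mem_set.
  by split => /=; exact: ltW.
have dd := differentiable_dot y.
have sd : smooth_on [set x : 'cV[R]_n | x != 0] (fun x => dot x x)
  by exact: smooth_on_dot.
have sk : smooth_on [set x : 'cV[R]_n | x != 0] (fun x => dot x x + k).
  by apply: smooth_onD => //; exact: smooth_on_cst.
have sek : smooth_on [set x : 'cV[R]_n | x != 0] (fun x => e * (dot x x + k)).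
  by apply: smooth_onM => //; exact: smooth_on_cst.
have dc (c : R) : differentiable (cst c : 'cV[R]_n -> R) y
  by exact: differentiable_cst.
have Lz : laplacian z y = laplacian w y + e * (2 * n)%:R.
  rewrite (laplacianD o) // (laplacianZ o) // (laplacianD o) //;
    last exact: smooth_on_cst.
  by rewrite laplacian_dot laplacian_cst addr0.
have pw i : partial i w y = - (2 * e * y i 0).
  have := p0 i; rewrite /z (partialD _ (smooth_on_diff sw y0) (smooth_on_diff
    sek y0)).
  rewrite (partialM _ (dc e) (smooth_on_diff sk y0)) (partialD _ dd (dc k)).
  rewrite !partial_cst partial_dot mulr0 !addr0 => /eqP.
  by rewrite addr_eq0 => /eqP -> /=; congr (- _); ring.
have := Ew y y0; rewrite /ou_op.
have -> : \sum_i y i 0 * partial i w y = - (2 * e * dot y y).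
  rewrite /dot mulr_sumr -sumrN; apply: eq_bigr => i _; rewrite pw; ring.
move: zy L0; rewrite Lz /z /k => zy L0 Ey.
have D0 : 0 < dot y y by rewrite dot_gt0.
have N0 : 0 <= (2 * n)%:R :> R by [].
clear -zy L0 Ey e0 D0 N0.
move: (2 * n)%:R (laplacian w y) (w y) (dot y y) zy L0 Ey D0 N0 => N L W D *.
have : 0 < e * D by rewrite mulr_gt0.
have : 0 <= e * N by rewrite mulr_ge0 // ltW.
lra.
Qed.

(** * The Bochner formula for the logarithm *)

(** The gradient of log w and its square are handled as quotients of derivatives
    of w, so that they are smooth by the rules above. *)
Section Bochner.
Context {R : realType} {n : nat} (U : set 'cV[R]_n) (w : 'cV[R]_n -> R).
Hypotheses (oU : open U) (sw : smooth_on U w) (w0 : forall x, U x -> w x != 0).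

Definition dlog (i : 'I_n) (x : 'cV[R]_n) : R := partial i w x * (w x)^-1.

Definition dlog_sq (x : 'cV[R]_n) : R := \sum_i dlog i x * dlog i x.

Lemma smooth_dlog i : smooth_on U (dlog i).
Proof.
exact: (smooth_onM oU (smooth_on_partial i sw) (smooth_onV oU w0 sw)).
Qed.

Lemma smooth_dlog_sq : smooth_on U dlog_sq.
Proof.
by apply: (smooth_on_sum oU) => i; apply: (smooth_onM oU); exact: smooth_dlog.
Qed.

Lemma partial_dlog i k x : U x ->
  partial k (dlog i) x =
  partial k (partial i w) x * (w x)^-1 - dlog i x * dlog k x.
Proof.
move=> Ux; rewrite /dlog.
rewrite (partialM _ (smooth_on_diff (smooth_on_partial i sw) Ux)
  (smooth_on_diff (smooth_onV oU w0 sw) Ux)).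
rewrite (partialV _ (smooth_on_diff sw Ux) (w0 Ux)).
by move: (partial k (partial i w) x) (partial i w x) (partial k w x) => p q r;
  ring.
Qed.

Lemma partial_dlogC i k x : U x -> partial k (dlog i) x = partial i (dlog k) x.
Proof.
move=> Ux; rewrite (partial_dlog i k Ux) (partial_dlog k i Ux).
have -> : partial k (partial i w) x = partial i (partial k w) x.
  exact: (partialC oU k i sw Ux).
by rewrite (mulrC (dlog i x) (dlog k x)).
Qed.

Lemma partial_dlog_sq k x : U x ->
  partial k dlog_sq x = 2 * \sum_i dlog i x * partial k (dlog i) x.
Proof.
move=> Ux; rewrite partial_sum => [|i]; last first.
  exact: smooth_on_diff (smooth_onM oU (smooth_dlog i) (smooth_dlog i)) Ux.
rewrite mulr_sumr; apply: eq_bigr => i _; have dG :=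
  smooth_on_diff (smooth_dlog i) Ux.
by rewrite (partialM _ dG dG); ring.
Qed.

Hypothesis ew : forall x, U x -> ou_op w x = w x.

(** The equation for log w: the zero order term of the equation for w becomes
    the constant 1, and the nonlinear term is the squared gradient. *)
Lemma div_dlog x : U x ->
  \sum_i partial i (dlog i) x = 1 + 2^-1 * (\sum_i x i 0 * dlog i x) - dlog_sq
    x.
Proof.
move=> Ux; rewrite (eq_bigr _ (fun i _ => partial_dlog i i Ux)).
rewrite big_split /= sumrN -mulr_suml -/(laplacian w x) -/(dlog_sq x);
  congr (_ - _).
have -> : \sum_i x i 0 * dlog i x = (\sum_i x i 0 * partial i w x) * (w x)^-1.
  by rewrite mulr_suml; apply: eq_bigr => i _; rewrite /dlog mulrA.
have := ew Ux; rewrite /ou_op => /eqP; rewrite subr_eq => /eqP ->.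
by rewrite mulrDl divff ?w0 // mulrA.
Qed.

(** The vector field dlog is curl free, so its Laplacian is the gradient of its
    divergence, which div_dlog computes. *)
Lemma laplacian_dlog i x : U x ->
  laplacian (dlog i) x =
  2^-1 * (dlog i x + \sum_j x j 0 * partial i (dlog j) x) - partial i dlog_sq x.
Proof.
move=> Ux.
transitivity (partial i (fun y => \sum_k partial k (dlog k) y) x).
  rewrite partial_sum => [|k]; last first.
    exact: smooth_on_diff (smooth_on_partial k (smooth_dlog k)) Ux.
  apply: eq_bigr => k _.
  transitivity (partial k (partial i (dlog k)) x).
    by apply: (partial_eq_on oU) (Ux) => y Uy; exact: partial_dlogC.
  exact: (partialC oU k i (smooth_dlog k) Ux).
have sx j : smooth_on U (fun y : 'cV[R]_n => y j 0 * dlog j y).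
  exact: smooth_onM (smooth_on_coord oU j) (smooth_dlog j).
have sX : smooth_on U (fun y => \sum_j y j 0 * dlog j y)
  by exact: smooth_on_sum.
have s1 : smooth_on U (fun y => (cst 1 y : R) + cst 2^-1 y * (\sum_j y j 0 *
  dlog j y)).
  apply: (smooth_onD oU (smooth_on_cst oU _)).
  exact: (smooth_onM oU (smooth_on_cst oU _) sX).
have s2 : smooth_on U (fun y => cst (-1) y * dlog_sq y).
  exact: (smooth_onM oU (smooth_on_cst oU _) smooth_dlog_sq).
transitivity (partial i (fun y =>
  ((cst 1 y : R) + cst 2^-1 y * (\sum_j y j 0 * dlog j y)) + cst (-1) y *
    dlog_sq y) x).
  by apply: (partial_eq_on oU) (Ux) => y Uy; rewrite (div_dlog Uy) /= mulN1r.
have dc (c : R) : differentiable (cst c : 'cV[R]_n -> R) x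
  by exact: differentiable_cst.
rewrite (partialD _ (smooth_on_diff s1 Ux) (smooth_on_diff s2 Ux)).
rewrite (partialM _ (dc _) (smooth_on_diff smooth_dlog_sq Ux)).
rewrite (partialD _ (dc 1)); last first.
  exact: smooth_on_diff (smooth_onM oU (smooth_on_cst oU _) sX) Ux.
rewrite (partialM _ (dc _) (smooth_on_diff sX Ux)) !partial_cst.
rewrite partial_sum => [|j]; last exact: smooth_on_diff (sx j) Ux.
have -> : \sum_j partial i (fun y : 'cV[R]_n => y j 0 * dlog j y) x =
    dlog i x + \sum_j x j 0 * partial i (dlog j) x.
  rewrite (eq_bigr (fun j => (i == j)%:R * dlog j x + x j 0 * partial i (dlog
    j) x)).
    rewrite big_split /=; congr (_ + _).
    rewrite (bigD1 i) //= eqxx mul1r big1 ?addr0 // => j ji.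
    by rewrite eq_sym (negbTE ji) mul0r.
  move=> j _; rewrite (partialM _ (differentiable_coord _ _ _) (smooth_on_diff
    (smooth_dlog j) Ux)).
  by rewrite partial_coord; ring.
by rewrite /=; ring.
Qed.

(** Bochner formula in flat space: the Laplacian of the squared gradient is
    twice the squared Hessian plus twice the pairing of the gradient with its
    Laplacian, and laplacian_dlog expresses the latter by lower order terms. *)
Lemma laplacian_dlog_sq x : U x ->
  laplacian dlog_sq x =
  2 * (\sum_i \sum_k partial k (dlog i) x * partial k (dlog i) x) + dlog_sq x +
  2^-1 * (\sum_k x k 0 * partial k dlog_sq x) -
  2 * (\sum_i dlog i x * partial i dlog_sq x).
Proof.
move=> Ux.
rewrite (laplacian_sum oU) // => [|j]; last exact: smooth_onM (smooth_dlog j)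
  (smooth_dlog j).
have alg (g s b p : R) :
    g * (2^-1 * (g + b) - p) + 2 * s + g * (2^-1 * (g + b) - p) =
    2 * s + g * g + g * b - 2 * (g * p) by field.
transitivity (\sum_i (2 * (\sum_k partial k (dlog i) x * partial k (dlog i) x) +
   dlog i x * dlog i x + dlog i x * (\sum_j x j 0 * partial i (dlog j) x) -
   2 * (dlog i x * partial i dlog_sq x))).
  apply: eq_bigr => i _; rewrite (laplacianM oU) //; try exact: smooth_dlog.
  by rewrite laplacian_dlog // alg.
have split4 (a b c d : 'I_n -> R) : \sum_i (2 * a i + b i + c i - 2 * d i) =
    2 * (\sum_i a i) + \sum_i b i + \sum_i c i - 2 * \sum_i d i.
  by rewrite !mulr_sumr -!big_split -sumrB.
rewrite split4; congr (_ + _ + _ - _).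
have -> : \sum_k x k 0 * partial k dlog_sq x =
    2 * \sum_k \sum_i x k 0 * (dlog i x * partial k (dlog i) x).
  rewrite mulr_sumr; apply: eq_bigr => k _; rewrite partial_dlog_sq //
    -mulr_sumr; ring.
rewrite mulKf ?pnatr_eq0 // exchange_big /=; apply: eq_bigr => i _.
rewrite mulr_sumr; apply: eq_bigr => j _.
by rewrite (partial_dlogC j i Ux) mulrCA.
Qed.

End Bochner.

(** * The interior gradient estimate *)

(** Cauchy-Schwarz against the constant vector; it bounds the square of a trace
    by the squared Hilbert-Schmidt norm. *)
Lemma sum_sqr_ge (R : realFieldType) (n : nat) (a : 'I_n -> R) :
  (\sum_i a i) ^+ 2 <= n%:R * \sum_i a i * a i.
Proof.
case: n a => [|n] a; first by rewrite !big_ord0 mulr0 expr0n.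
set S := \sum_i a i; set m := S / n.+1%:R.
have n0 : (n.+1%:R : R) != 0 by rewrite pnatr_eq0.
have : 0 <= \sum_i (a i - m) ^+ 2 by apply: sumr_ge0 => i _; exact: sqr_ge0.
have -> : \sum_i (a i - m) ^+ 2 = \sum_i a i * a i - S ^+ 2 / n.+1%:R.
  rewrite (eq_bigr (fun i => a i * a i + (- 2 * m) * a i + m ^+ 2)).
    rewrite !big_split /= -mulr_sumr -/S sumr_const card_ord -mulr_natl.
    by rewrite /m; field.
  by move=> i _; ring.
by rewrite subr_ge0 ler_pdivrMr ?ltr0n // mulrC.
Qed.

(** The inequality at the maximum point of the cutoff quantity h^2 Q. There h is
    the cutoff and N its squared gradient, H2 and D are the squared norm and
    the trace of the Hessian of log w, A and B are the derivatives of h along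
    the position vector and along grad log w, X is the derivative of log w along
    the position vector, LQ the Laplacian of Q and d = |x|^2. When Q >= 8 the
    trace D is at most - Q / 2, so the Hessian term is of order Q^2 and absorbs
    all others up to h^2 Q / 16 <= 70 N + 20 h <= 300 a; when Q < 8 there is
    nothing to absorb. *)
Lemma bernstein_algebra (R : realFieldType) (a h N Q H2 A B X D LQ d : R) :
  0 < h -> h <= a -> a <= 1 -> 0 <= Q -> N = 4 * (a - h) -> d <= 4 ->
  h * h * LQ <= 6 * N * Q + 16 * h * Q ->
  h * h * LQ = 2 * (h * h) * H2 + h * h * Q - h * Q * A + 4 * h * Q * B ->
  D ^+ 2 <= 4 * H2 -> D = 1 + 2^-1 * X - Q ->
  A <= 2^-1 * (d + N) -> X <= 2^-1 * (d + Q) ->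
  - (16^-1 * (h * h * Q) + 64 * N) <= 4 * h * B ->
  h * h * Q <= 70 ^+ 2 * a.
Proof.
move=> h0 ha a1 Q0 NE d4 L1 L2 DH DE Ab Xb Bb.
have hh0 : 0 < h * h by rewrite mulr_gt0.
have hha : h * h <= a by nra.
have [Q8|Q8] := ltrP Q 8.
  have : h * h * Q <= a * 8 by apply: ler_pM => //; exact: ltW.
  lra.
have D2 : Q * Q <= 16 * H2.
  have : 2^-1 * Q <= - D by lra.
  nra.
have S1 : h * h * (Q * Q) <= h * h * (16 * H2) by rewrite ler_pM2l.
have hQ : 0 < h * Q by rewrite mulr_gt0 //; lra.
have S2 : h * Q * A <= h * Q * 4 by rewrite ler_pM2l //; lra.
have S3 : Q * - (16^-1 * (h * h * Q) + 64 * N) <= Q * (4 * h * B).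
  by rewrite ler_wpM2l.
have S4 : Q * (h * h * Q) <= Q * (70 ^+ 2 * a).
  have S5 : 0 <= Q * (a - h) by rewrite mulr_ge0 // subr_ge0.
  have S6 : 0 <= h * h * Q by rewrite mulr_ge0 // ltW.
  have S7 : Q * N = 4 * (Q * (a - h)) by rewrite NE; ring.
  nra.
have Qp : 0 < Q by apply: lt_le_trans Q8.
by rewrite ler_pM2l in S4.
Qed.

(** The Bochner identity at a critical point of h^2 Q, where h grad Q equals
    - 2 Q grad h; S1 and S2 are the two directional derivatives of Q. *)
Lemma cutoff_bochner (R : realFieldType) (h q S1 S2 A B H L : R) :
  h * S1 = - 2 * q * A -> h * S2 = - 2 * q * B ->
  L = 2 * H + q + 2^-1 * S1 - 2 * S2 ->
  h * h * L = 2 * (h * h) * H + h * h * q - h * q * A + 4 * h * q * B.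
Proof.
move=> e1 e2 ->.
transitivity (2 * (h * h) * H + h * h * q + 2^-1 * h * (h * S1) - 2 * h * (h *
  S2)).
  by ring.
by rewrite e1 e2; field.
Qed.

Lemma ler_mean (R : realFieldType) (x y : R) : x * y <= 2^-1 * (x * x + y * y).
Proof. by have := sqr_ge0 (x - y); lra. Qed.

Lemma young (R : realFieldType) (x y : R) :
  - (16^-1 * (x * x) + 64 * (y * y)) <= 4 * (x * y).
Proof. by have := sqr_ge0 (4^-1 * x + 8 * y); lra. Qed.

(** Interior gradient estimate on the ball of radius sqrt a about c. The
    function F = h^2 Q, with the cutoff h = a - |x - c|^2, vanishes on the
    boundary of the ball, so its maximum is interior unless F = 0; the first and
    second order conditions there feed bernstein_algebra. The cutoff is squared
    so that the terms in grad h, of order a, can be absorbed after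
    multiplication of the Bochner identity by h^2. *)
Lemma dlog_sq_bound (R : realType) (U : set 'cV[R]_4) (w : 'cV[R]_4 -> R)
    (c : 'cV[R]_4) (a : R) :
  open U -> smooth_on U w -> (forall x, U x -> w x != 0) ->
  (forall x, U x -> ou_op w x = w x) -> 0 < a -> a <= 1 ->
  (forall x, dot (x - c) (x - c) <= a -> U x /\ dot x x <= 4) ->
  a * dlog_sq w c <= 70 ^+ 2.
Proof.
move=> oU sw w0 ew a0 a1 ballU.
pose dc (x : 'cV[R]_4) : R := dot (x - c) (x - c).
pose h (x : 'cV[R]_4) : R := a + (-1) * dc x.
have sdcV V : open V -> smooth_on V dc.
  move=> oV.
  apply: (smooth_on_eq oV (u := fun x => \sum_i (x i 0 + - c i 0) * (x i 0 + -
    c i 0))).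
    by move=> x _; apply: eq_bigr => i _; rewrite !mxE.
  have s i : smooth_on V (fun x : 'cV[R]_4 => x i 0 + - c i 0).
    exact: (smooth_onD oV (smooth_on_coord oV i) (smooth_on_cst oV _)).
  by apply: (smooth_on_sum oV) => i; exact: (smooth_onM oV (s i) (s i)).
have sdc := sdcV U oU.
have sNdc : smooth_on U (fun x => (-1) * dc x).
  exact: (smooth_onM oU (smooth_on_cst oU (-1)) sdc).
have sh : smooth_on U h by exact: (smooth_onD oU (smooth_on_cst oU a) sNdc).
pose Q := dlog_sq w.
have sQ : smooth_on U Q by exact: smooth_dlog_sq.
have Q0 x : 0 <= Q x by apply: sumr_ge0 => i _; rewrite -expr2 sqr_ge0.
pose P (x : 'cV[R]_4) : R := h x * h x.
have sP : smooth_on U P by exact: (smooth_onM oU sh sh).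
pose F (x : 'cV[R]_4) : R := P x * Q x.
have sF : smooth_on U F by exact: (smooth_onM oU sP sQ).
have dcc : dc c = 0 by rewrite /dc subrr; apply/eqP; rewrite dot_eq0.
have hc : h c = a by rewrite /h dcc; ring.
pose A := [set x : 'cV[R]_4 | dc x <= a].
have Ac : A c by rewrite /A /= dcc ltW.
have dcont : continuous dc.
  by move=> x; apply/differentiable_continuous/(smooth_on_diff (sdcV setT
    openT)).
have cA : compact A.
  apply: (@compact_bounded_coords _ _ _ 4).
    apply: (@closed_comp _ _ dc [set y | y <= a]); last exact: closed_le.
    by move=> x _; exact: dcont.
  move=> x i /ballU[_ x4]; have := coord_le_dot x i.
  rewrite -real_normK ?num_real // => h1.
  have := normr_ge0 (x i 0); move: `|x i 0| h1 => y y2 y0.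
  have : y ^+ 2 <= 4 ^+ 2 by apply: le_trans y2 _; apply: le_trans x4 _; lra.
  by rewrite ler_sqr ?nnegrE.
have [||y /set_mem yA ymax] := compact_EVT_max (f := F) _ cA.
- by exists c.
- apply: continuous_in_subspaceT => x /set_mem /ballU[Ux _].
  exact/differentiable_continuous/(smooth_on_diff sF).
have Fcy : a * a * Q c <= F y by rewrite -{1 2}hc; apply: ymax; exact/mem_set.
have [Uy y4] := ballU y yA.
suff : F y <= 70 ^+ 2 * a.
  by move=> /(le_trans Fcy); rewrite -mulrA [X in _ <= X]mulrC ler_pM2l.
have hy0 : 0 <= h y by rewrite /h; move: yA; rewrite /A /=; lra.
have [hy|hy] := eqVneq (h y) 0.
  have -> : F y = 0 by rewrite /F /P hy !mul0r.
  by rewrite mulr_ge0 ?sqr_ge0 // ltW.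
have {hy}hy0 : 0 < h y by rewrite lt_neqAle eq_sym hy.
have dya : dc y < a by move: hy0; rewrite /h; lra.
have pdc i : partial i dc y = 2 * (y - c) i 0.
  by rewrite (partial_translate (fun z => dot z z)) partial_dot.
have dsF := smooth_on_diff sF Uy.
have d1 (b : R) : differentiable (cst b : 'cV[R]_4 -> R) y
  by exact: differentiable_cst.
have ph i : partial i h y = - 2 * (y - c) i 0.
  rewrite (partialD _ (d1 a) (smooth_on_diff sNdc Uy)).
  by rewrite (partialM _ (d1 (-1)) (smooth_on_diff sdc Uy)) !partial_cst pdc
    /=; ring.
have Lh : laplacian h y = - 8.
  rewrite (laplacianD oU (smooth_on_cst oU a) sNdc Uy) laplacian_cst.
  rewrite (laplacianZ oU (-1) sdc Uy) (laplacian_translate (fun z =>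
    dot z z)) laplacian_dot.
  have -> : (2 * 4)%N%:R = 8 :> R by [].
  by ring.
pose N : R := \sum_i partial i h y * partial i h y.
have NE : N = 4 * (a - h y).
  rewrite (_ : a - h y = dc y); last by rewrite /h; ring.
  rewrite /N /dc /dot mulr_sumr; apply: eq_bigr => i _; rewrite ph; ring.
have pP i : partial i P y = 2 * h y * partial i h y.
  by rewrite (partialM _ (smooth_on_diff sh Uy) (smooth_on_diff sh Uy)); ring.
have LP : laplacian P y = 2 * N - 16 * h y.
  by rewrite (laplacianM oU sh sh Uy) -/N Lh; ring.
have sNF : smooth_on U (fun x => (-1) * F x).
  exact: (smooth_onM oU (smooth_on_cst oU (-1)) sF).
have [|pF LF] := laplacian_at_min oU sNF Uy.
  have : \forall x \near y, dc x < a by move/cvgr_lt: (dcont y); exact.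
  apply: filterS => x xa; rewrite !mulN1r lerN2; apply: ymax; apply/mem_set.
  exact: ltW.
have {}pF i : h y * partial i Q y = - 2 * partial i h y * Q y.
  have := pF i; rewrite (partialM _ (d1 (-1)) dsF) partial_cst mulr0 addr0 /=
    => E.
  have {E} : partial i F y = 0 by move: E; rewrite mulN1r => /eqP;
    rewrite oppr_eq0 => /eqP.
  rewrite (partialM _ (smooth_on_diff sP Uy) (smooth_on_diff sQ Uy)) pP /P => E.
  apply: (mulfI (lt0r_neq0 hy0)); move: E.
  by move: (partial i Q y) (partial i h y) => p q E; rewrite -[LHS]subr0 -E;
    ring.
have {}LF : h y * h y * laplacian Q y <= 6 * N * Q y + 16 * h y * Q y.
  move: LF; rewrite (laplacianZ oU (-1) sF Uy) mulN1r oppr_ge0.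
  rewrite (laplacianM oU sP sQ Uy) LP.
  have -> : \sum_i partial i P y * partial i Q y = - 4 * Q y * N.
    rewrite /N mulr_sumr; apply: eq_bigr => i _; rewrite pP.
    by rewrite (_ : 2 * _ * _ * _ = 2 * partial i h y * (h y * partial i Q y));
      [rewrite pF|]; ring.
  rewrite /P; move: (laplacian Q y) (Q y) (h y) (N) => LQ q t m LF'.
  have -> : 6 * m * q + 16 * t * q = t * t * LQ - (t * t * LQ +
    2 * (- 4 * q * m) + q * (2 * m - 16 * t)) by ring.
  by rewrite lerDl oppr_ge0.
have B := laplacian_dlog_sq oU sw w0 ew Uy.
pose G i := dlog w i y.
have B1 : h y * (\sum_k y k 0 * partial k Q y) =
  - 2 * Q y * (\sum_k y k 0 * partial k h y).
  rewrite [LHS]mulr_sumr [RHS]mulr_sumr; apply: eq_bigr => i _.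
  by rewrite [LHS]mulrCA pF; ring.
have B2 : h y * (\sum_k G k * partial k Q y) = - 2 * Q y * (\sum_k G k *
  partial k h y).
  rewrite [LHS]mulr_sumr [RHS]mulr_sumr; apply: eq_bigr => i _.
  by rewrite [LHS]mulrCA pF; ring.
apply: (@bernstein_algebra _ a (h y) N (Q y)
  (\sum_i \sum_k partial k (dlog w i) y * partial k (dlog w i) y)
  (\sum_k y k 0 * partial k h y) (\sum_k G k * partial k h y)
  (\sum_k y k 0 * G k) (\sum_i partial i (dlog w i) y) (laplacian Q y) (dot y
    y)) => //.
- by rewrite /h mulN1r gerDl oppr_le0 dot_ge0.
- exact: cutoff_bochner B1 B2 B.
- apply: le_trans (sum_sqr_ge _) _; rewrite ler_pM2l //; apply: ler_sum => i _.
  rewrite (bigD1 i) //= lerDl; apply: sumr_ge0 => k _; rewrite -expr2;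
    exact: sqr_ge0.
- exact: (div_dlog oU sw w0 ew Uy).
- rewrite /dot /N -big_split /= mulr_sumr; apply: ler_sum => i _.
  by apply: ler_mean.
- rewrite /dot /Q /dlog_sq -big_split /= mulr_sumr; apply: ler_sum => i _.
  by apply: ler_mean.
- rewrite /Q /dlog_sq /N !mulr_sumr -big_split /= -sumrN; apply: ler_sum => i _.
  by rewrite mulrACA -[4 * h y * _]mulrA [h y * (_ * _)]mulrA; exact: young.
Qed.

(** * The Harnack inequality on spheres *)

Section Harnack.
Context {R : realType} (w : 'cV[R]_4 -> R).
Hypotheses (ew : ou_eigen w) (wp : forall x, x != 0 -> 0 < w x).

(** The ball of radius |x| / 2 about x avoids the origin, which makes the
    estimate scale invariant. *)
Lemma gradient_estimate x : x != 0 -> dot x x <= 1 ->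
  dot x x * dlog_sq w x <= 4 * 70 ^+ 2.
Proof.
move=> x0 x1; have d0 : 0 < dot x x by rewrite dot_gt0.
have [sw Ew] := ew.
have := @dlog_sq_bound R [set x | x != 0] w x (dot x x / 4) (@open_neq0 R 4) sw.
have w0 y : y != 0 -> w y != 0 by move=> /wp /lt0r_neq0.
move=> /(_ w0 Ew) H.
suff : dot x x / 4 * dlog_sq w x <= 70 ^+ 2.
  by rewrite mulrAC ler_pdivrMr // [4 * _]mulrC.
apply: H; [lra|lra|] => y yx; split.
  apply/eqP => y0; move: yx; rewrite y0 sub0r dotNr dotC dotNr opprK; lra.
move: yx; rewrite dot_sub.
have := dot_ge0 (y - 2 *: x).
have -> : dot (y - 2 *: x) (y - 2 *: x) = 4 * dot x x - 4 * dot x y + dot y y.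
  rewrite /dot !mulr_sumr -sumrN -!big_split; apply: eq_bigr => i _.
  by rewrite !mxE /=; ring.
lra.
Qed.

(** When the angle between x and y is at most a right angle, the chord between
    them stays at distance at least sqrt (a / 2) from the origin, so the
    gradient estimate bounds the derivative of log w along it, and its length
    is at most sqrt (2 a). *)
Lemma harnack_acute x y (a : R) : 0 < a -> a <= 1 ->
  dot x x = a -> dot y y = a -> 0 <= dot x y -> w y <= expR 280 * w x.
Proof.
move=> a0 a1 xa ya xy; pose e := y - x; pose z (t : R) := x + t *: e.
have dz t : dot (z t) (z t) = ((1 - t) ^+ 2 + t ^+ 2) * a + 2 * (t * (1 - t)) *
  dot x y.
  by rewrite dot_segment xa ya; ring.
have xya : dot x y <= a.
  by have := dot_ge0 (y - x); rewrite dot_sub xa ya; lra.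
have zlo (t : R) : 0 <= t <= 1 -> a <= 2 * dot (z t) (z t).
  move=> /andP[t0 t1]; rewrite dz.
  have : 0 <= 2 * (t * (1 - t)) * dot x y by rewrite !mulr_ge0 // subr_ge0.
  have : 0 <= a * (1 - 2 * t) ^+ 2 by rewrite mulr_ge0 ?sqr_ge0 // ltW.
  lra.
have zhi (t : R) : 0 <= t <= 1 -> dot (z t) (z t) <= a.
  move=> /andP[t0 t1]; rewrite dz.
  have : 0 <= 2 * (t * (1 - t)) * (a - dot x y) by rewrite !mulr_ge0 //
    subr_ge0.
  lra.
have z0 (t : R) : 0 <= t <= 1 -> z t != 0.
  by move=> t01; rewrite -dot_gt0; have := zlo t t01; lra.
have [sw _] := ew.
pose phi (t : R) := ln (w (z t)).
pose dphi (t : R) := \sum_i e i 0 * dlog w i (z t).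
have D (t : R) : 0 <= t <= 1 -> is_derive t 1 phi (dphi t).
  move=> t01; have dw := smooth_on_diff sw (z0 t t01).
  have D1 := @is_derive_line R _ w x e t (diff_derivable dw).
  have D2 := is_derive1_ln (wp (z0 t t01)).
  apply: is_derive_eq (is_derive1_comp D2 D1) _.
  rewrite derive_partial // mulr_sumr; apply: eq_bigr => i _.
  by rewrite /dlog; ring.
have Db (t : R) : 0 <= t <= 1 -> dphi t <= 280.
  move=> t01; have ge := gradient_estimate (z0 t t01) (le_trans (zhi t t01) a1).
  have lo := zlo t t01; set Q := dlog_sq w (z t) in ge.
  have Q0 : 0 <= Q by apply: sumr_ge0 => i _; rewrite -expr2 sqr_ge0.
  have aQ : a * Q <= 280 * 140.
    have : a * Q <= 2 * dot (z t) (z t) * Q by rewrite ler_wpM2r.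
    lra.
  (* weight that balances the two terms of Young's inequality between the
     direction e and the gradient *)
  pose l : R := 140 / a.
  have l0 : 0 < l by rewrite divr_gt0.
  have de : dot e e <= 2 * a by rewrite dot_sub xa ya; lra.
  have S : dphi t <= 2^-1 * (l * dot e e + l^-1 * Q).
    rewrite /dphi /dot /Q /dlog_sq !mulr_sumr -big_split /= mulr_sumr.
    apply: ler_sum => i _; have := sqr_ge0 (l * e i 0 - dlog w i (z t)).
    move: (e i 0) (dlog w i (z t)) => p q.
    have -> : (l * p - q) ^+ 2 = 2 * l * (2^-1 * (l * (p * p) + l^-1 * (q * q))
      - p * q).
      by field; rewrite gt_eqF.
    by rewrite pmulr_rge0 ?subr_ge0 // mulr_gt0.
  apply: le_trans S _.
  have S1 : l * dot e e <= 280.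
    have -> : 280 = l * (2 * a) :> R by rewrite /l; field; rewrite gt_eqF.
    by rewrite ler_pM2l.
  have S2 : l^-1 * Q <= 280.
    have -> : l^-1 * Q = a * Q / 140 by rewrite /l; field; rewrite gt_eqF.
    by rewrite ler_pdivrMr.
  lra.
have phi_cont : {within `[0, 1], continuous phi}.
  by apply: derivable_within_continuous => s; rewrite in_itv /= => /D[].
have Do (s : R) : s \in `]0, 1[%R -> is_derive s 1 phi (dphi s).
  by rewrite in_itv /= => /andP[s0 s1]; apply: D; rewrite !ltW.
have [s s01] := MVT ltr01 Do phi_cont.
rewrite subr0 mulr1 => E.
have wz (t : R) : 0 <= t <= 1 -> 0 < w (z t) by move=> /z0/wp.
have y1 : z 1 = y by rewrite /z /e scale1r addrC subrK.
have x1 : z 0 = x by rewrite /z scale0r addr0.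
have wx : 0 < w x by rewrite -x1 wz // lexx ler01.
have wy : 0 < w y by rewrite -y1 wz // lexx ler01.
rewrite -(lnK wx) -(lnK wy) -expRD ler_expR.
have : phi 1 - phi 0 <= 280.
  by rewrite E; apply: Db; move: s01; rewrite in_itv /= =>
    /andP[/ltW -> /ltW ->].
by rewrite /phi y1 x1 lerBlDr.
Qed.

End Harnack.

(** Multiplication by the quaternion i: an isometry of R^4 that sends every
    vector to an orthogonal one. *)
Definition quaternion_i (R : realType) (x : 'cV[R]_4) : 'cV[R]_4 :=
  \col_k [:: - x (inord 1) 0; x (inord 0) 0; - x (inord 3) 0; x (inord 2) 0]`_k.

Lemma dot4E (R : realType) (x y : 'cV[R]_4) :
  dot x y = x (inord 0) 0 * y (inord 0) 0 + x (inord 1) 0 * y (inord 1) 0 +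
    x (inord 2) 0 * y (inord 2) 0 + x (inord 3) 0 * y (inord 3) 0.
Proof.
rewrite /dot (eq_bigr (fun i : 'I_4 => x (inord i) 0 * y (inord i) 0)).
  by rewrite !big_ord_recr big_ord0 /= add0r.
by move=> i _; rewrite inord_val.
Qed.

Lemma dot_quaternion_i (R : realType) (x : 'cV[R]_4) :
  dot (quaternion_i x) (quaternion_i x) = dot x x.
Proof. by rewrite !dot4E !mxE !inordK //=; ring. Qed.

Lemma dot_quaternion_i_orth (R : realType) (x : 'cV[R]_4) :
  dot x (quaternion_i x) = 0.
Proof. by rewrite !dot4E !mxE !inordK //=; ring. Qed.

(** The vectors ix and - ix are orthogonal to x, and one of them makes an angle
    of at most a right angle with y; so two chords as in harnack_acute join any
    two points of the sphere. *)
Lemma harnack_sphere (R : realType) (w : 'cV[R]_4 -> R) x y (a : R) :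
  ou_eigen w -> (forall x, x != 0 -> 0 < w x) -> 0 < a -> a <= 1 ->
  dot x x = a -> dot y y = a -> w y <= expR 280 ^+ 2 * w x.
Proof.
move=> ew wp a0 a1 xa ya.
suff [z [za xz zy]] : exists z, [/\ dot z z = a, 0 <= dot x z & 0 <= dot z y].
  apply: le_trans (harnack_acute ew wp a0 a1 za ya zy) _.
  rewrite expr2 -mulrA ler_pM2l ?expR_gt0 //.
  exact: (harnack_acute ew wp a0 a1 xa za xz).
have [jy|jy] := leP 0 (dot (quaternion_i x) y).
  exists (quaternion_i x); rewrite dot_quaternion_i dot_quaternion_i_orth.
  by split.
exists (- quaternion_i x); split.
- by rewrite dotNr dotC dotNr opprK dot_quaternion_i.
- by rewrite dotNr dot_quaternion_i_orth oppr0.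
- by rewrite dotC dotNr dotC oppr_ge0 ltW.
Qed.

(** * The Liouville theorem *)

Lemma liouville_ou_eigen (R : realType) (u : 'cV[R]_4 -> R) (M K : R) :
  ou_eigen u -> (forall x, x != 0 -> 0 < u x) ->
  (forall x, x != 0 -> K <= dot x x -> u x <= M) ->
  exists b, forall x, x != 0 -> u x = b * (dot x x)^-1.
Proof.
move=> eu up uM.
pose h (x : 'cV[R]_4) := dot x x * u x.
have hu x : x != 0 -> u x = h x * (dot x x)^-1.
  by move=> x0; rewrite /h mulrAC divff ?mul1r // dot_eq0.
have eq := ou_eigen_inv_dot R.
have nz (x : 'cV[R]_4) a : 0 < a -> a <= dot x x -> x != 0.
  by move=> a0 ax; rewrite -dot_gt0; exact: lt_le_trans ax.
(* on the sphere |x|^2 = a, comparing u with c r^-2 is comparing h with c *)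
have r1 (x : 'cV[R]_4) (a c : R) : 0 < a -> dot x x = a ->
  1 * u x + c * (dot x x)^-1 = (h x + c) / a.
  move=> a0 xa; rewrite (hu x) ?xa; first by ring.
  by apply: (nz x a) => //; rewrite xa.
have qle1 (x : 'cV[R]_4) (c : R) : 1 <= dot x x -> - `|c| <=
  c * (dot x x)^-1 <= `|c|.
  move=> x1; rewrite -ler_norml normrM ler_piMr // ger0_norm //.
    by rewrite invf_le1 // (lt_le_trans ltr01).
  by rewrite invr_ge0 dot_ge0.
have lower (a k : R) : 0 < a -> (forall x, dot x x = a -> k <= h x) ->
    forall x, a <= dot x x -> k <= h x.
  move=> a0 hk x ax; have x0 := nz x a a0 ax.
  have ew := ou_eigen_lincomb 1 (- k) eu eq.
  have := @exterior_minimum_principle R 4 _ a (- `|- k|) 1 a0 ew.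
  move=> /(_ _ _ x ax); rewrite (r1 x (dot x x)) ?dot_gt0 //.
  rewrite pmulr_lge0 ?invr_gt0 ?dot_gt0 // subr_ge0; apply.
    move=> y ya; rewrite (r1 y a) // divr_ge0 ?(ltW a0) // subr_ge0; exact: hk.
  move=> y y1; have /andP[qy _] := qle1 y (- k) y1.
  by rewrite mul1r ler_wpDl // ltW // up // (nz y 1).
have upper (a k : R) : 0 < a -> (forall x, dot x x = a -> h x <= k) ->
    forall x, a <= dot x x -> h x <= k.
  move=> a0 hk x ax; have x0 := nz x a a0 ax.
  have ew := ou_eigen_lincomb (- 1) k eu eq.
  have E (y : 'cV[R]_4) : -1 * u y + k * (dot y y)^-1 =
    - (1 * u y + (- k) * (dot y y)^-1).
    by ring.
  have := @exterior_minimum_principle R 4 _ a (- M - `|k|) (Num.max 1 K) a0 ew.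
  move=> /(_ _ _ x ax); rewrite E (r1 x (dot x x)) ?dot_gt0 // oppr_ge0.
  rewrite pmulr_lle0 ?invr_gt0 ?dot_gt0 // subr_le0; apply.
    move=> y ya; rewrite E (r1 y a) // oppr_ge0 pmulr_lle0 ?invr_gt0 //
      subr_le0.
    exact: hk.
  move=> y; rewrite ge_max => /andP[y1 yK]; have /andP[qy _] := qle1 y k y1.
  by rewrite mulN1r lerD // lerN2 uM // (nz y 1).
pose S := [set h x | x in [set x : 'cV[R]_4 | x != 0]].
have h0 x : x != 0 -> 0 < h x by move=> x0; rewrite mulr_gt0 ?dot_gt0 // up.
have Si : has_inf S.
  split; last by exists 0 => _ [x x0 <-]; rewrite ltW // h0.
  exists (h (const_mx 1)), (const_mx 1) => //=.
  by apply/eqP => /colP/(_ 0); rewrite !mxE => /eqP; rewrite oner_eq0.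
pose b := inf S.
have bh x : x != 0 -> b <= h x by move=> x0; apply: ge_inf;
  [exact: Si.2|exists x].
pose C : R := expR 280 ^+ 2.
have C0 : 0 < C by rewrite exprn_gt0 // expR_gt0.
have key (d : R) y : 0 < d -> y != 0 -> h y <= b - d + C * (2 * d).
  move=> d0 y0.
  have [_ [x0 x00 <-] hx0] := inf_adherent d0 Si; rewrite -/b in hx0.
  pose a := Num.min (dot x0 x0) (Num.min (dot y y) 1).
  have a0 : 0 < a by rewrite !lt_min !dot_gt0 y0 ltr01 /= andbT.
  have [ax0 ay a1] : [/\ a <= dot x0 x0, a <= dot y y & a <= 1].
    by split; rewrite /a !ge_min lexx ?orbT.
  (* otherwise the comparison from the sphere outwards would contradict the
     choice of x0 *)
  have [x1 x1a hx1] : exists2 x1, dot x1 x1 = a & h x1 < b + d.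
    apply: contrapT => nx; move: hx0; rewrite ltNge => /negP; apply.
    apply: (lower a) => // x xa; rewrite leNgt; apply/negP => hx.
    by apply: nx; exists x.
  have ew := ou_eigen_lincomb 1 (- (b - d)) eu eq.
  have wp x : x != 0 -> 0 < 1 * u x + - (b - d) * (dot x x)^-1.
    move=> xn; have dx : 0 < dot x x by rewrite dot_gt0.
    rewrite (r1 x (dot x x)) // divr_gt0 //; have := bh x xn; lra.
  apply: (upper a) => // x xa.
  have := harnack_sphere ew wp a0 a1 x1a xa.
  rewrite (r1 x a) // (r1 x1 a) // mulrA ler_pM2r ?invr_gt0 // -/C => H.
  have : C * (h x1 + - (b - d)) <= C * (2 * d) by rewrite ler_pM2l //; lra.
  lra.
exists b => y y0; rewrite hu //; congr (_ * _); apply/eqP.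
rewrite eq_le bh // andbT leNgt; apply/negP => by_.
(* with this d the bound reads h y <= b - d + (h y - b) / 2 *)
pose d := (h y - b) / (4 * C).
have d0 : 0 < d by rewrite divr_gt0 ?subr_gt0 // mulr_gt0.
have := key d y d0 y0.
have -> : C * (2 * d) = (h y - b) / 2 by rewrite /d; field; rewrite gt_eqF.
lra.
Qed.

(** * Descent to the cone *)

(** The gradient of |x|^2 / 4 is x / 2. *)
Lemma drift_laplacian_ou (R : realType) (n : nat) (u : 'cV[R]_n -> R) x :
  drift_laplacian (fun y => dot y y / 4) u x = ou_op u x.
Proof.
rewrite /drift_laplacian /ou_op; congr (_ - _); rewrite mulr_sumr.
apply: eq_bigr => i _; rewrite !mxE.
have -> : partial i (fun y : 'cV[R]_n => dot y y / 4) x = 2^-1 * x i 0.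
  rewrite (partialM (v := cst 4^-1)); [|exact: differentiable_dot|
    exact: differentiable_cst].
  by rewrite partial_cst partial_dot /=; field.
by rewrite mulrA.
Qed.

Theorem theorem3p1 (R : realType) (Gamma : finOrthGroup R 4)
    (Gamma_free : acts_freely_on_sphere Gamma)
    (v : cone Gamma -> R)
    (v_smooth : smooth_off_vertex v)
    (v_pos : forall p : cone Gamma, p != vertex Gamma -> 0 < v p)
    (v_eq : forall p : cone Gamma, p != vertex Gamma ->
      cone_drift_laplacian (fun q : cone Gamma => cone_radius q ^+ 2 / 4%:R) v p
        = v p)
    (v_bounded :
      (limf_esup (fun p : cone Gamma => (v p)%:E) (cone_infty Gamma) < +oo)%E) :
  exists b : R, forall p : cone Gamma, p != vertex Gamma ->
    v p = b * (cone_radius p) ^- 2.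
Proof.
pose u : 'cV[R]_4 -> R := cone_lift v.
pose f (q : cone Gamma) : R := cone_radius q ^+ 2 / 4%:R.
have fE : cone_lift f = (fun x => dot x x / 4).
  by apply/funext => x; rewrite /cone_lift /f cone_radius_pi enorm_sqr.
have o := @open_neq0 R 4.
have UE : [set x | \pi_(cone Gamma) x != vertex Gamma] = [set x | x != 0].
  by apply/funext => y; rewrite /= pi_vertex.
have su : smooth_on [set x | x != 0] u by rewrite -UE; exact: v_smooth.
have sf : smooth_off_vertex f.
  rewrite /smooth_off_vertex UE fE.
  exact: (smooth_onM o (smooth_on_dot o) (smooth_on_cst o _)).
have pi0 (x : 'cV[R]_4) : x != 0 -> \pi_(cone Gamma) x != vertex Gamma.
  by rewrite pi_vertex.
have eu : ou_eigen u.
  split=> // x x0; rewrite -drift_laplacian_ou -fE.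
  rewrite -(cone_drift_laplacian_pi sf v_smooth x0).
  exact: v_eq (pi0 x x0).
have [M [K uM]] : exists M K, forall x, x != 0 -> K <= dot x x -> u x <= M.
  have [_ [A [M0 _ MA] <-] supA] := ereal_inf_lt v_bounded.
  exists (fine (ereal_sup ((fun p => (v p)%:E) @` A))), ((`|M0| + 1) ^+ 2) =>
    x x0 Kx.
  have Ax : A (\pi_(cone Gamma) x).
    apply: MA; rewrite /= cone_radius_pi.
    apply: (lt_le_trans (y := `|M0| + 1)); first by rewrite ltr_pwDr //
      ler_norm.
    rewrite -(@ler_pXn2r _ 2) // ?nnegrE ?sqrtr_ge0 ?addr_ge0 //.
    by rewrite enorm_sqr.
  have vA : ((v (\pi_(cone Gamma) x))%:E <= ereal_sup ((fun p =>
    (v p)%:E) @` A))%E.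
    by apply: ereal_sup_ubound; exists (\pi_(cone Gamma) x).
  move: vA supA; case: (ereal_sup _) => [r| |] //=.
have [b ub] := liouville_ou_eigen eu (fun x x0 => v_pos _ (pi0 x x0)) uM.
exists b => p; rewrite -[p]reprK => p0.
have x0 : repr p != 0 by rewrite -(pi_vertex Gamma).
by rewrite cone_radius_pi enorm_sqr; exact: ub.
Qed.
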